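(* Let $d \ge 5$ and let $P$ be a closed polygonal curve embedded in $\mathbb{R}^d$ consisting of $n$ line segments. Then there exists an embedded triangulated PL disk in $\mathbb{R}^d$ that is locally flat, has $P$ as its PL boundary, and contains $n$ triangles.
   Context: A closed polygonal curve with $n$ line segments embedded in $\mathbb{R}^d$ is a simple closed curve that is a cyclic union of $n$ straight line segments (edges). An embedded triangulated PL disk is a topological closed 2-disk given as the union of a finite simplicial complex of (flat) triangles in $\mathbb{R}^d$. It has $P$ as its PL boundary if its boundary, with the boundary edges of the triangulation, is exactly $P$ with its $n$ edges (no subdivision). Local flatness: a surface $\Sigma$ embedded in $\mathbb{R}^d$ is locally flat if each point $x \in \Sigma$ has a neighborhood $N$ in $\mathbb{R}^d$ such that the pair $(N, N \cap \Sigma)$ is homeomorphic to $(D \times I^{d-2}, D \times \{0\}^{d-2})$, where $D$ is a 2-disk and $I=[-1,1]$, when $x$ is an interior point of $\Sigma$, with $D \times \{0\}^{d-2}$ replaced by $D^+ \times \{0\}^{d-2}$, where $D^+ \subset D$ is a half-disk with $x$ corresponding to a point of its diameter, when $x$ is a boundary point of $\Sigma$. *)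

(* Defs.v *)
From HB Require Import structures.
From mathcomp Require Import all_boot all_order all_algebra finmap.
From mathcomp Require Import all_classical all_reals all_analysis.

Set Implicit Arguments.
Unset Strict Implicit.
Unset Printing Implicit Defensive.

Import Order.TTheory GRing.Theory Num.Theory.
Import numFieldNormedType.Exports.

Local Open Scope classical_set_scope.
Local Open Scope ring_scope.

Definition homeo (X Y : topologicalType) (A : set X) (B : set Y)
    (f : X -> Y) : Prop :=
  [/\ {within A, continuous f}, set_bij A B f &
      exists2 g : Y -> X, {within B, continuous g} & {in A, cancel f g}].

(* f is a homeomorphism of pairs (A, A') -> (B, B'); the intended use has
   A' included in A and B' included in B. *)
Definition pair_homeo (X Y : topologicalType) (A A' : set X) (B B' : set Y)
    (f : X -> Y) : Prop :=
  homeo A B f /\ f @` A' = B'.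

Section Models.
Variable R : realType.

Definition disk : set 'rV[R]_2 :=
  [set x : 'rV[R]_2 | x 0 0 ^+ 2 + x 0 1 ^+ 2 <= 1].

Definition circle : set 'rV[R]_2 :=
  [set x : 'rV[R]_2 | x 0 0 ^+ 2 + x 0 1 ^+ 2 = 1].

Definition half_disk : set 'rV[R]_2 := disk `&` [set x : 'rV[R]_2 | 0 <= x 0 1].

Definition diameter : set 'rV[R]_2 := disk `&` [set x : 'rV[R]_2 | x 0 1 = 0].

Definition cube (m : nat) : set 'rV[R]_m :=
  [set x : 'rV[R]_m | forall i, -1 <= x 0 i <= 1].

End Models.

Arguments disk {R}.
Arguments circle {R}.
Arguments half_disk {R}.
Arguments diameter {R}.
Arguments cube {R} m.

Section Geometry.
Variables (R : realType) (d : nat).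
Local Notation E := 'rV[R]_d.

Definition hull (A : {fset E}) : set E :=
  [set x | exists w : E -> R,
     [/\ (forall v, v \in A -> 0 <= w v), \sum_(v <- A) w v = 1 &
         x = \sum_(v <- A) w v *: v]].

Definition affinely_independent (A : {fset E}) : Prop :=
  forall w : E -> R,
    \sum_(v <- A) w v = 0 -> \sum_(v <- A) w v *: v = 0 ->
    forall v, v \in A -> w v = 0.

(* A closed polygon with n edges is given by its cyclic sequence of vertices;
   the i-th edge joins P i to P (i + 1 mod n), and subdivision vertices (with
   collinear adjacent edges) are allowed. *)
Definition polygon_edge (n : nat) (P : 'I_n -> E) (i : 'I_n) : {fset E} :=
  [fset P i; P (ordS i)]%fset.

Definition polygon_edges (n : nat) (P : 'I_n -> E) : set {fset E} :=
  [set e | exists i, e = polygon_edge P i].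

Definition polygon_curve (n : nat) (P : 'I_n -> E) : set E :=
  \bigcup_(e in polygon_edges P) hull e.

(* The parametrization of the polygon by R/nZ (edge index i, position s in
   [0, 1[ along that edge) is injective; this forces 3 <= n. *)
Definition simple_polygon (n : nat) (P : 'I_n -> E) : Prop :=
  (0 < n)%N /\
  forall (i j : 'I_n) (s t : R), 0 <= s < 1 -> 0 <= t < 1 ->
    (1 - s) *: P i + s *: P (ordS i) = (1 - t) *: P j + t *: P (ordS j) ->
    i = j /\ s = t.

(* A triangle is the set of its three vertices.  The second condition says
   that two triangles meet exactly in the common face spanned by their common
   vertices (hull of the empty set is empty), so that T together with all the
   faces of its members is a geometric simplicial complex. *)
Definition triangle_complex (T : {fset {fset E}}) : Prop :=
  (forall t, t \in T -> #|` t|%fset = 3%N /\ affinely_independent t) /\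
  (forall s t, s \in T -> t \in T ->
     hull s `&` hull t = hull (s `&` t)%fset).

Definition carrier (T : {fset {fset E}}) : set E :=
  \bigcup_(t in [set` T]) hull t.

Definition boundary_edges (T : {fset {fset E}}) : set {fset E} :=
  [set e | #|` e|%fset = 2%N /\ exists! t, t \in T /\ (e `<=` t)%fset].

Definition triangulated_disk (T : {fset {fset E}}) : Prop :=
  triangle_complex T /\ exists f : 'rV[R]_2 -> E, homeo disk (carrier T) f.

Definition has_PL_boundary (T : {fset {fset E}}) (n : nat) (P : 'I_n -> E) :
    Prop :=
  (exists f : 'rV[R]_2 -> E,
     pair_homeo disk circle (carrier T) (polygon_curve P) f) /\
  boundary_edges T = polygon_edges P.

Definition flat_at_interior (S : set E) (x : E) : Prop :=
  exists (N : set E) (f : E -> 'rV[R]_2 * 'rV[R]_(d - 2)),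
    nbhs x N /\
    pair_homeo N (N `&` S)
      (disk `*` cube (d - 2)) (disk `*` [set 0]) f.

Definition flat_at_boundary (S : set E) (x : E) : Prop :=
  exists (N : set E) (f : E -> 'rV[R]_2 * 'rV[R]_(d - 2)),
    [/\ nbhs x N,
        pair_homeo N (N `&` S)
          (disk `*` cube (d - 2)) (half_disk `*` [set 0]) f &
        (diameter `*` [set 0]) (f x)].

(* Local flatness of a surface S whose manifold boundary is B. *)
Definition locally_flat (S B : set E) : Prop :=
  (forall x, (S `\` B) x -> flat_at_interior S x) /\
  (forall x, B x -> flat_at_boundary S x).

End Geometry.

(* Main.v *)
(* The disk is the cone over P from a generic apex q.  Local flatness is obtained
   from a global statement: a homeomorphism of R^d carries the cone onto a flat
   disk.  In generic linear coordinates centred at q, write a point of the cone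
   as r (p - q) with p on P.  If e is an embedding of the disk into R^d that
   stays injective after forgetting some coordinates, then Tietze's theorem
   gives a shear of R^d that replaces the forgotten coordinates by arbitrary
   continuous functions (Klee's trick).  Since d >= 5, the last coordinate can
   be forgotten and replaced by r.  Then the one before it can be replaced by
   r tau(p), where tau is chosen such that (x, tau) is injective on P for a
   suitable linear coordinate x.  The coordinates x, r tau, r now determine the
   point, so the other ones can be replaced by any planar embedding h of the
   disk, after which x, r tau, r can be replaced by 0.  The result is (h, 0);
   taking for h the identity or a map onto a half disk gives all the charts. *)

Require Import Defs.
From mathcomp Require Import all_boot all_order all_algebra finmap.
From mathcomp Require Import all_classical all_reals all_analysis.
From mathcomp Require Import ring lra zify.

Set Implicit Arguments.
Unset Strict Implicit.
Unset Printing Implicit Defensive.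

Import Order.TTheory GRing.Theory Num.Theory.
Import numFieldNormedType.Exports.

Local Open Scope classical_set_scope.
Local Open Scope ring_scope.

(** * Shears *)

Lemma rV_continuous (R : realType) (X : topologicalType) (d : nat)
    (f : X -> 'rV[R]_d) :
  (forall i, continuous (fun x => f x 0 i)) -> continuous f.
Proof.
move=> cf x; apply/cvg_ballP => e e0.
have : \forall y \near x, forall i, ball (f x 0 i) e (f y 0 i).
  by apply: filter_forall => i; have /cvg_ballP := cf i x; apply.
apply: filterS => y H.
by split => // i j; rewrite (ord1 i); exact: H.
Qed.

Lemma coord_continuous_comp (R : realType) (X : topologicalType) (d : nat)
    (f : X -> 'rV[R]_d) i :
  continuous f -> continuous (fun x => f x 0 i).
Proof.
move=> cf x; apply: (@continuous_comp _ _ _ f (fun M : 'rV[R]_d => M 0 i)).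
  exact: cf.
exact: coord_continuous.
Qed.

(** On the compact set [D] the injective map [e] is a homeomorphism onto a closed image, so [phi]
    after the inverse of [e] is continuous there and bounded. The bounded Tietze theorem extends it
    to the whole space. *)
Lemma tietze_along (R : realType) (X : topologicalType) (d : nat) (D : set X)
    (e : X -> 'rV[R]_d) (phi : X -> R) :
  compact D -> continuous e -> set_inj D e -> continuous phi ->
  exists2 psi : 'rV[R]_d -> R, continuous psi &
    forall v, D v -> psi (e v) = phi v.
Proof.
move=> cD ce ie cphi.
have clA B : closed B -> closed (e @` (D `&` B)).
  move=> cB; apply: compact_closed; first exact: norm_hausdorff.
  apply: continuous_compact; first exact: continuous_subspaceT.
  exact: compact_closedI.
have clD : closed (e @` D) by rewrite -(setIT D); apply/clA/closedT.
have [->|/set0P[x0 Dx0]] := eqVneq D set0.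
  by exists (fun=> 0) => [|v []]; exact: cst_continuous.
(* [s] inverts [e] on the image of [D]; the value [x0] elsewhere is arbitrary. *)
pose s y := if pselect ((e @` D) y) is left p then sval (cid2 p) else x0.
have sP v : D v -> s (e v) = v.
  move=> Dv; rewrite /s; case: pselect => [p|]; last by case; exists v.
  case: cid2 => w Dw /= ew. exact: ie (mem_set Dw) (mem_set Dv) ew.
have cs : {within e @` D, continuous (phi \o s)}.
  apply/continuous_closedP => B cB; apply/closed_subspaceP.
  exists (e @` (D `&` phi @^-1` B)).
    by apply: clA; exact: ((continuous_closedP phi).1 cphi).
  apply/seteqP; split => [_ [[v [Dv Bv] <-] _]|y [By [v Dv ev]]] /=.
    split; last by exists v.
    by change (B (phi (s (e v)))); rewrite sP.
  rewrite -ev in By *; have {By} : B (phi (s (e v))) by [].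
  by rewrite sP // => Bv; split; exists v.
have [M [_ Mb]] : bounded_set (phi @` D).
  apply: compact_bounded; apply: continuous_compact cD.
  exact: continuous_subspaceT.
(* The bound [|M| + 1] is positive and exceeds [M], as both the extension theorem and [Mb]
   demand. *)
have := @continuous_bounded_extension _ R
  (@pseudometric_normal R 'rV[R]_d) _ clD (phi \o s) (`|M| + 1).
case.
- by rewrite ltr_wpDl.
- by [].
- move=> _ [v Dv <-] /=; rewrite sP //; apply: (Mb (`|M| + 1)); last by exists v.
  by rewrite (le_lt_trans (ler_norm M)) // ltrDl.
move=> psi [epsi cpsi _]; exists psi => // v Dv.
by rewrite -epsi ?inE //=; [rewrite sP | exists v].
Qed.

(** The parametrizations are matched point by point, not only their images, so that a chain of
    shears still controls where each point of [D] goes. *)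
Definition ambient_equiv (R : realType) (X : Type) (d k : nat) (D : set X)
    (e : X -> 'rV[R]_d) (h : X -> 'rV[R]_k) : Prop :=
  exists (S : 'rV[R]_d -> 'rV[R]_k) (S' : 'rV[R]_k -> 'rV[R]_d),
    [/\ continuous S, continuous S', cancel S S', cancel S' S &
        forall v, D v -> S (e v) = h v].

Lemma ambient_equiv_trans (R : realType) (X : Type) (d k l : nat) (D : set X)
    (e : X -> 'rV[R]_d) (g : X -> 'rV[R]_k) (h : X -> 'rV[R]_l) :
  ambient_equiv D e g -> ambient_equiv D g h -> ambient_equiv D e h.
Proof.
move=> [S [S' [cS cS' SK S'K Se]]] [T [T' [cT cT' TK T'K Tg]]].
exists (T \o S), (S' \o T'); split.
- by move=> x; apply: continuous_comp; [exact: cS | exact: cT].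
- by move=> x; apply: continuous_comp; [exact: cT' | exact: cS'].
- exact: can_comp.
- exact: can_comp.
- by move=> v Dv /=; rewrite Se // Tg.
Qed.

(* Klee's trick: the homeomorphism is the shear y |-> y + Psi (mask y), where
   Psi only moves the coordinates outside I and only reads those in I; Tietze
   provides Psi. *)
Lemma ambient_equiv_shear (R : realType) (X : topologicalType) (d : nat)
    (D : set X) (I : pred 'I_d) (e h : X -> 'rV[R]_d) :
  compact D -> continuous e -> continuous h ->
  (forall v i, I i -> e v 0 i = h v 0 i) ->
  (forall v w, D v -> D w -> (forall i, I i -> e v 0 i = e w 0 i) -> v = w) ->
  ambient_equiv D e h.
Proof.
move=> cD ce ch eh inj.
pose mask (y : 'rV[R]_d) : 'rV[R]_d := \row_i (if I i then y 0 i else 0).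
have cmask : continuous mask.
  apply: rV_continuous => i; rewrite /mask; under eq_fun do rewrite mxE.
  case: (I i); last exact: cst_continuous.
  exact: coord_continuous.
have cme : continuous (mask \o e).
  by move=> x; apply: continuous_comp; [exact: ce | exact: cmask].
have ime : set_inj D (mask \o e).
  move=> v w; rewrite !inE => Dv Dw /rowP E; apply: inj => // i Ii.
  by have := E i; rewrite !mxE Ii.
have H i : exists psi : 'rV[R]_d -> R, continuous psi /\
    forall v, D v -> psi (mask (e v)) = h v 0 i - e v 0 i.
  have [|psi cpsi psiE] := tietze_along (phi := fun v => h v 0 i - e v 0 i)
    cD cme ime; last by exists psi.
  by move=> x; apply: cvgB; apply: coord_continuous_comp.
have /choice [psi psiP] := H.
pose Psi (y : 'rV[R]_d) : 'rV[R]_d := \row_i (if I i then 0 else psi i y).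
have cPsi : continuous Psi.
  apply: rV_continuous => i; rewrite /Psi; under eq_fun do rewrite mxE.
  case: (I i); first exact: cst_continuous.
  by case: (psiP i).
have cPm : continuous (Psi \o mask).
  by move=> x; apply: continuous_comp; [exact: cmask | exact: cPsi].
(* [Psi] does not move the coordinates that it reads, so subtracting it undoes adding it. *)
have maskD y z : mask (y + Psi z) = mask y.
  by apply/rowP => i; rewrite !mxE; case: (I i); rewrite ?addr0.
have maskB y z : mask (y - Psi z) = mask y.
  by apply/rowP => i; rewrite !mxE; case: (I i); rewrite ?subr0.
have cont_id : continuous (@id 'rV[R]_d) by move=> x; exact: cvg_id.
exists (fun y => y + Psi (mask y)), (fun y => y - Psi (mask y)); split.
- by move=> x; apply: (continuousD (f := id) (g := Psi \o mask)); [exact: cont_id | exact: cPm].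
- by move=> x; apply: (continuousB (f := id) (g := Psi \o mask)); [exact: cont_id | exact: cPm].
- by move=> y; rewrite maskD addrK.
- by move=> y; rewrite maskB subrK.
- move=> v Dv; apply/rowP => i; rewrite 2!mxE; case: ifPn => Ii.
    by rewrite addr0 eh.
  by case: (psiP i) => _ ->//; rewrite addrC subrK.
Qed.

(** * Pseudo-polar coordinates in the plane *)

Lemma continuous_near_dist (R : realType) (X : topologicalType) (f : X -> R) x :
  {for x, continuous f} <->
  forall e, 0 < e -> \forall y \near x, `|f x - f y| < e.
Proof. exact: cvgrPdist_lt. Qed.

(** Where [c x] is nonzero the branch is constant near [x]; where it vanishes, both branches stay
    close to their common value. *)
Lemma continuous_glue (R : realType) (X : topologicalType) (c f g : X -> R) x :
  {for x, continuous c} -> {for x, continuous f} -> {for x, continuous g} ->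
  (c x = 0 -> f x = g x) ->
  {for x, continuous (fun y => if 0 <= c y then f y else g y)}.
Proof.
move=> cc cf cg fg; apply/continuous_near_dist => e e0.
have := (continuous_near_dist f x).1 cf e e0.
have := (continuous_near_dist g x).1 cg e e0.
have [c0|c0|c0] := ltgtP (c x) 0; last first.
- apply: filterS2 => y hg hf; case: ifP => _; last by rewrite fg.
  exact: hf.
- move=> _; have := (continuous_near_dist c x).1 cc _ c0.
  apply: filterS2 => y; rewrite ltr_norml ltrBlDr ltrDl => /andP[_ /ltW ->].
  by [].
- move=> + _; have := (continuous_near_dist c x).1 cc (- c x).
  rewrite oppr_gt0 => /(_ c0); apply: filterS2 => y.
  rewrite ltr_norml opprK ltrBrDr => /andP[+ _].
  by rewrite -ltrBrDl subrr ltNge => /negbTE ->.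
Qed.

Section PseudoPolar.
Variable R : realType.
Implicit Types (v w : 'rV[R]_2) (r s N : R).

(** The Euclidean norm is written out because the norm carried by row vectors is the sup norm. *)
Definition radius v : R := Num.sqrt (v 0 0 ^+ 2 + v 0 1 ^+ 2).

(* An algebraic substitute for the angle: on the unit circle it runs
   injectively through [0, N[, counterclockwise from (1, 0), being affine in
   the first coordinate on each of the two half circles. *)
Definition pseudo_angle N v : R :=
  let a := N / 4 * (1 - v 0 0 / radius v) in
  if 0 <= v 0 1 then a else N - a.

Lemma rV2P v w : v 0 0 = w 0 0 -> v 0 1 = w 0 1 -> v = w.
Proof.
move=> h0 h1; apply/rowP => -[[|[|//]] i2].
  by rewrite (_ : Ordinal i2 = 0) //; apply: val_inj.
by rewrite (_ : Ordinal i2 = 1) //; apply: val_inj.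
Qed.

Lemma sqr_sum_ge0 v : 0 <= v 0 0 ^+ 2 + v 0 1 ^+ 2.
Proof. by rewrite addr_ge0 ?sqr_ge0. Qed.

Lemma radius_ge0 v : 0 <= radius v. Proof. exact: sqrtr_ge0. Qed.

Lemma sqr_radius v : radius v ^+ 2 = v 0 0 ^+ 2 + v 0 1 ^+ 2.
Proof. by rewrite sqr_sqrtr // sqr_sum_ge0. Qed.

Lemma diskE v : disk v <-> radius v <= 1.
Proof.
rewrite /disk /= -sqr_radius; have := radius_ge0 v => r0.
by rewrite -{1}(expr1n _ 2) ler_sqr ?nnegrE.
Qed.

Lemma circleE v : circle v <-> radius v = 1.
Proof.
rewrite /circle /= -sqr_radius; have r0 := radius_ge0 v.
by split => [/eqP|->]; [rewrite sqrp_eq1 // => /eqP | rewrite expr1n].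
Qed.

Lemma radius_eq0 v : radius v = 0 -> v = 0.
Proof.
move=> r0; have /eqP := sqr_radius v; rewrite r0 expr0n eq_sym.
rewrite paddr_eq0 ?sqr_ge0 // !sqrf_eq0 => /andP[/eqP h0 /eqP h1].
by apply: rV2P; rewrite mxE.
Qed.

Lemma radius0 : radius 0 = 0.
Proof. by rewrite /radius !mxE expr0n addr0 sqrtr0. Qed.

Lemma radius_continuous : continuous radius.
Proof.
move=> v; apply: (@continuous_comp _ _ _ (fun v : 'rV[R]_2 => v 0 0 ^+ 2 + v 0 1 ^+ 2)).
  have c (i : 'I_2) : continuous (fun w : 'rV[R]_2 => w 0 i ^+ 2).
    move=> w; apply: (continuousM (s := fun w : 'rV[R]_2 => w 0 i)
      (t := fun w : 'rV[R]_2 => w 0 i)); exact: coord_continuous.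
  apply: (continuousD (f := fun w : 'rV[R]_2 => w 0 0 ^+ 2)
    (g := fun w : 'rV[R]_2 => w 0 1 ^+ 2)); exact: c.
exact: sqrt_continuous.
Qed.

Lemma abs_coord_div_radius v : `|v 0 0 / radius v| <= 1.
Proof.
have := radius_ge0 v; rewrite le_eqVlt => /predU1P[<-|r0].
  by rewrite invr0 mulr0 normr0.
rewrite normrM normfV (gtr0_norm r0) ler_pdivrMr // mul1r.
rewrite -ler_sqr ?nnegrE ?normr_ge0 ?radius_ge0 // sqr_radius.
by rewrite real_normK ?num_real // lerDl sqr_ge0.
Qed.

(** Strictness off the horizontal axis keeps the angles of the open lower half circle strictly
    between [N / 2] and [N], away from those of the upper one. *)
Lemma abs_coord_div_radius_lt v : v 0 1 != 0 -> `|v 0 0 / radius v| < 1.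
Proof.
move=> y0; rewrite lt_neqAle abs_coord_div_radius andbT.
apply: contra y0 => /eqP x1.
have r0 : radius v != 0.
  apply: contra_eq_neq x1 => ->.
  by rewrite invr0 mulr0 normr0 eq_sym oner_neq0.
have : (v 0 0 / radius v) ^+ 2 = 1.
  by rewrite -real_normK ?num_real // x1 expr1n.
rewrite expr_div_n => /(canRL (divfK _)); rewrite sqrf_eq0 => /(_ r0).
by rewrite mul1r sqr_radius => /eqP; rewrite -subr_eq0 opprD addrA subrr sub0r oppr_eq0 sqrf_eq0.
Qed.

Lemma pseudo_angle_itv N v : 0 < N -> 0 <= pseudo_angle N v < N.
Proof.
move=> N0; rewrite /pseudo_angle; have := abs_coord_div_radius v.
have := @abs_coord_div_radius_lt v; set x := _ / _.
rewrite ler_norml ltr_norml => xlt /andP[h1 h2]; case: ifPn => hy.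
  by apply/andP; split; nra.
have /andP[] : -1 < x < 1 by apply: xlt; rewrite lt_eqF // ltNge.
by move=> h3 h4; apply/andP; split; nra.
Qed.

(** On one half circle the angle gives the first coordinate, and the radius then gives the second,
    whose sign is known. Points on different halves have angles on different sides of [N / 2]. *)
Lemma polar_inj N v w : 0 < N -> radius v = radius w -> radius v != 0 ->
  pseudo_angle N v = pseudo_angle N w -> v = w.
Proof.
move=> N0 rvw r0.
have := abs_coord_div_radius v; have := abs_coord_div_radius w.
have := @abs_coord_div_radius_lt v; have := @abs_coord_div_radius_lt w.
rewrite /pseudo_angle -rvw; set x := v 0 0 / _; set x' := w 0 0 / _.
rewrite !ler_norml !ltr_norml => lw lv /andP[h1 h2] /andP[h3 h4].
have xx : N / 4 * (1 - x) = N / 4 * (1 - x') -> v 0 0 = w 0 0.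
  have N4 : N / 4 != 0 by rewrite mulf_neq0 ?gt_eqF.
  by move/(mulfI N4)/addrI/oppr_inj/(mulIf (invr_neq0 r0)).
have yy : v 0 0 = w 0 0 -> v 0 1 ^+ 2 = w 0 1 ^+ 2.
  by move=> e; have := sqr_radius v; rewrite rvw sqr_radius e => /addrI.
case: ifPn => hv; case: ifPn => hw E.
- by apply: rV2P; [exact: xx | apply/eqP; rewrite -(@eqrXn2 _ 2) ?yy // xx].
- have /andP[] : -1 < x' < 1 by apply: lw; rewrite lt_eqF // ltNge.
  by move=> ? ?; exfalso; nra.
- have /andP[] : -1 < x < 1 by apply: lv; rewrite lt_eqF // ltNge.
  by move=> ? ?; exfalso; nra.
- have e : v 0 0 = w 0 0 by apply: xx; move/addrI/oppr_inj: E.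
  move: hv hw; rewrite -!ltNge => hv hw.
  apply: rV2P => //; apply: oppr_inj; apply/eqP.
  by rewrite -(@eqrXn2 _ 2) ?oppr_ge0 ?ltW // !sqrrN yy.
Qed.

(** The angle is compared only off the centre, because in a cone it is recovered only after
    cancelling the radius. *)
Lemma polar_eq N v w : 0 < N -> radius v = radius w ->
  (radius w != 0 -> pseudo_angle N v = pseudo_angle N w) -> v = w.
Proof.
move=> N0 r; have [r0 _|r0 /(_ isT) a] := eqVneq (radius w) 0.
  by rewrite (radius_eq0 r0) (radius_eq0 (v := v)) // r.
by apply: polar_inj a; rewrite ?r.
Qed.

Lemma polar_surj N r s : 0 < N -> 0 < r -> 0 <= s < N ->
  exists v, radius v = r /\ pseudo_angle N v = s.
Proof.
move=> N0 r0 /andP[s0 sN].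
have main (x y : R) : `|x| <= 1 -> y = Num.sqrt (1 - x ^+ 2) \/ y = - Num.sqrt (1 - x ^+ 2) ->
    forall v, v = \row_(i < 2) (if i == 0 then r * x else r * y) ->
    radius v = r /\ pseudo_angle N v =
      (if 0 <= y then N / 4 * (1 - x) else N - N / 4 * (1 - x)).
  move=> x1 yE v vE.
  have y2 : y ^+ 2 = 1 - x ^+ 2.
    have : 0 <= 1 - x ^+ 2.
      by rewrite subr_ge0 -real_normK ?num_real // expr_le1.
    by move=> h; case: yE => ->; rewrite ?sqrrN sqr_sqrtr.
  have rv : radius v = r.
    rewrite /radius vE !mxE /= !exprMn -mulrDr y2 addrC subrK mulr1.
    by rewrite sqrtr_sqr gtr0_norm.
  split=> //; rewrite /pseudo_angle rv vE !mxE /= pmulr_rge0 //.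
  by rewrite (mulrC r) mulfK // gt_eqF.
have bound t : 0 <= t <= N / 2 -> `|1 - 4 * t / N| <= 1.
  move=> /andP[t0 tN]; have q0 : 0 <= 4 * t / N by apply: divr_ge0; lra.
  have q2 : 4 * t / N <= 2 by rewrite ler_pdivrMr //; lra.
  by rewrite ler_norml; apply/andP; split; lra.
(* The angle is inverted by the first coordinate [1 - 4 s / N] on the upper half circle, and by the
   same formula in [N - s] on the lower one. *)
have [sh|sh] := leP s (N / 2).
  have x1 : `|1 - 4 * s / N| <= 1 by apply: bound; rewrite s0.
  have [rv pv] := main _ _ x1 (or_introl erefl) _ erefl.
  eexists; split; first exact: rv.
  by rewrite pv sqrtr_ge0; field; exact: lt0r_neq0.
have x1 : `|1 - 4 * (N - s) / N| <= 1 by apply: bound; apply/andP; split; lra.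
have [rv pv] := main _ _ x1 (or_intror erefl) _ erefl.
eexists; split; first exact: rv; rewrite pv oppr_ge0 leNgt.
have q0 : 0 < 4 * (N - s) / N by apply: divr_gt0; lra.
have q2 : 4 * (N - s) / N < 2 by rewrite ltr_pdivrMr //; lra.
rewrite sqrtr_gt0 ifF; first by field; exact: lt0r_neq0.
by apply/negbTE; rewrite negbK; nra.
Qed.

(** At the centre the factor [radius] tends to 0 while [f] stays bounded on [[0, N]]. Elsewhere the
    angle jumps only across the positive half axis, where [f 0 = f N] closes the gap. *)
Lemma cone_continuous N (f : R -> R) : 0 < N -> continuous f -> f 0 = f N ->
  continuous (fun v => radius v * f (pseudo_angle N v)).
Proof.
move=> N0 cf f0N v; have [v0|r0] := eqVneq (radius v) 0.
  have vE := radius_eq0 v0.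
  have [c _ cM] : exists2 c, c \in `[0, N] & forall t, t \in `[0, N] -> `|f t| <= `|f c|.
    apply: (EVT_max (f := fun t => `|f t|)); first exact: ltW.
    apply: continuous_subspaceT => x; apply: cvg_norm; exact: cf.
  apply/continuous_near_dist => e e0; rewrite v0 mul0r.
  have M0 : 0 < `|f c| + 1 by rewrite ltr_wpDl.
  have := (continuous_near_dist radius v).1 (@radius_continuous v) _ (divr_gt0 e0 M0).
  apply: filterS => w.
  rewrite v0 !sub0r !normrN ltr_pdivlMr // => H.
  rewrite normrM; apply: le_lt_trans H; rewrite ler_wpM2l //.
  rewrite (le_trans (cM _ _)) ?lerDl //; rewrite in_itv /=.
  by have /andP[-> /ltW ->] := pseudo_angle_itv w N0.
apply: continuousM; first exact: radius_continuous.
pose a w := N / 4 * (1 - w 0 0 / radius w) : R.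
have ca : {for v, continuous a}.
  have cr : {for v, continuous (fun w => w 0 0 / radius w)}.
    apply: (continuousM (s := fun w : 'rV[R]_2 => w 0 0) (t := fun w => (radius w)^-1)).
      exact: coord_continuous.
    by apply: continuousV => //; exact: radius_continuous.
  apply: (continuousM (s := fun=> N / 4) (t := fun w => 1 - w 0 0 / radius w)).
    exact: cst_continuous.
  apply: (continuousB (f := fun=> (1 : R)) (g := fun w => w 0 0 / radius w : R)) => //.
  exact: cst_continuous.
have c1 : {for v, continuous (fun w => f (a w))}.
  by apply: (continuous_comp (f := a)) => //; exact: cf.
have c2 : {for v, continuous (fun w => f (N - a w))}.
  apply: (continuous_comp (f := fun w => N - a w)); last exact: cf.
  by apply: (continuousB (f := fun=> N)) => //; exact: cst_continuous.
(* The two half planes are glued along the horizontal axis, where [a] is 0 or [N / 2]: the branches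
   take the values [f 0] and [f N], or [f (N / 2)] twice. *)
rewrite (_ : (fun w => _) = (fun w => if 0 <= w 0 1 then f (a w) else f (N - a w))).
  apply: continuous_glue => //; first exact: coord_continuous.
  move=> y0; have : (v 0 0 / radius v) ^+ 2 = 1.
    have := sqr_radius v; rewrite y0 expr0n addr0 expr_div_n => <-.
    by rewrite divff // sqrf_eq0.
  move=> /eqP; rewrite sqrf_eq1 /a => /orP[] /eqP ->.
    by rewrite subrr mulr0 subr0.
  by congr f; field.
by apply/funext => w; rewrite /pseudo_angle; case: ifP.
Qed.

End PseudoPolar.

(** * Piecewise linear curves *)

Section PiecewiseLinear.
Variables (R : realType) (d : nat).
Implicit Types (Q : nat -> 'rV[R]_d) (n k : nat) (r s : R).

Definition clamp (x : R) : R := Num.min 1 (Num.max 0 x).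

(** Each edge enters through a ramp that is 0 before the edge and 1 after it, so no gluing at the
    vertices is needed for continuity. *)
Definition piecewise_linear Q n s : 'rV[R]_d :=
  Q 0%N + \sum_(0 <= i < n) clamp (s - i%:R) *: (Q i.+1 - Q i).

(** The ramps of the earlier edges equal 1 and telescope to [Q k]; those of the later edges
    vanish. *)
Lemma piecewise_linearE Q n k r : (k < n)%N -> 0 <= r <= 1 ->
  piecewise_linear Q n (k%:R + r) = (1 - r) *: Q k + r *: Q k.+1.
Proof.
move=> kn /andP[r0 r1]; rewrite /piecewise_linear.
have before m : (m <= k)%N ->
    Q 0%N + \sum_(0 <= i < m) clamp (k%:R + r - i%:R) *: (Q i.+1 - Q i) = Q m.
  elim: m => [|m IH] mk; first by rewrite big_geq // addr0.
  rewrite big_nat_recr //= addrA IH 1?ltnW //.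
  have mk' : m%:R + 1 <= k%:R :> R by rewrite natr1 ler_nat.
  rewrite /clamp (_ : Num.max 0 _ = k%:R + r - m%:R); last by apply/max_idPr; lra.
  rewrite (_ : Num.min 1 _ = 1); last by apply/min_idPl; lra.
  by rewrite scale1r addrC subrK.
rewrite (@big_cat_nat _ _ _ k.+1) //= addrA big_nat_recr //= addrA before //.
have -> : clamp (k%:R + r - k%:R) = r.
  rewrite /clamp (_ : k%:R + r - k%:R = r); last by ring.
  by rewrite (max_idPr r0) (min_idPr r1).
rewrite big_nat big1 ?addr0 => [|i /andP[ki _]]; last first.
  have ki' : k%:R + 1 <= i%:R :> R by rewrite natr1 ler_nat.
  rewrite /clamp (_ : Num.max 0 _ = 0); last by apply/max_idPl; lra.
  by rewrite (_ : Num.min 1 0 = 0) ?scale0r //; apply/min_idPr.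
by rewrite scalerBr scalerBl scale1r addrA addrAC.
Qed.

Lemma nat_frac_part n s : 0 <= s < n%:R ->
  exists k r, [/\ (k < n)%N, 0 <= r < 1 & s = k%:R + r].
Proof.
move=> /andP[s0 sn]; exists (Num.truncn s), (s - (Num.truncn s)%:R).
have /andP[h1 h2] := truncn_itv s0; split; last by rewrite addrC subrK.
  by rewrite -(ltr_nat R) (le_lt_trans h1).
by apply/andP; split; [lra | rewrite ltrBlDr addrC natr1].
Qed.

Lemma clamp_continuous : continuous clamp.
Proof.
move=> x.
have cid : continuous (id : R -> R) by move=> y; exact: cvg_id.
have cmax : continuous ((fun=> (0 : R)) \max (id : R -> R)).
  by move=> y; apply: continuous_max; [exact: cst_continuous | exact: cid].
have := @continuous_min R R (fun=> (1 : R)) _ x (@cst_continuous _ _ _ x) (cmax x).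
exact.
Qed.

Lemma piecewise_linear_continuous Q n i :
  continuous (fun s => piecewise_linear Q n s 0 i).
Proof.
have cc m : continuous (fun t : R => clamp (t - m%:R)).
  move=> t; have ct : {for t, continuous (fun t : R => t - m%:R)}.
    by apply: cvgB; [exact: cvg_id | exact: cvg_cst].
  exact: (continuous_comp ct (@clamp_continuous _)).
move=> s; rewrite /piecewise_linear.
under eq_fun do rewrite mxE summxE.
apply: cvgD; first exact: cvg_cst.
elim: n => [|n IH].
  by under eq_fun do rewrite big_geq //; rewrite big_geq //; exact: cvg_cst.
under eq_fun do rewrite big_nat_recr //=; rewrite big_nat_recr //=.
apply: cvgD => //; under eq_fun do rewrite mxE; rewrite mxE.
by apply: cvgM; [exact: cc | exact: cvg_cst].
Qed.

Lemma piecewise_linear0 Q n : piecewise_linear Q n 0 = Q 0%N.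
Proof.
rewrite /piecewise_linear big1 ?addr0 // => i _.
rewrite /clamp (_ : Num.max 0 _ = 0); last by apply/max_idPl; rewrite sub0r oppr_le0.
by rewrite (_ : Num.min 1 0 = 0) ?scale0r //; apply/min_idPr.
Qed.

Lemma piecewise_linearn Q n : (0 < n)%N -> piecewise_linear Q n n%:R = Q n.
Proof.
case: n => // n _; rewrite -natr1 piecewise_linearE // ?lexx ?ler01 //.
by rewrite subrr scale0r add0r scale1r.
Qed.

End PiecewiseLinear.

(** * General position *)

Section GeneralPosition.
Variable R : realType.

(** The product of the polynomials is nonzero, so it cannot vanish at as many distinct naturals as
    its size. *)
Lemma common_nonroot (ps : seq {poly R}) : (forall p, p \in ps -> p != 0) ->
  exists a, forall p, p \in ps -> p.[a] != 0.
Proof.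
move=> ps0; pose P := \prod_(p <- ps) p.
have P0 : P != 0 by rewrite prodf_seq_neq0; apply/allP => p /ps0.
pose s : seq R := [seq i%:R | i <- iota 0 (size P)].
have us : uniq s.
  rewrite map_inj_uniq ?iota_uniq // => i j /eqP; rewrite eqr_nat; exact: eqP.
have : ~~ all (root P) s.
  apply/negP => rP; have := max_poly_roots P0 rP us.
  by rewrite size_map size_iota ltnn.
case/allPn => a _ ra; exists a => p pin; apply: contra ra => pa.
by rewrite /root /P horner_prod prodf_seq_eq0; apply/hasP; exists p.
Qed.

(** The functional is taken on the moment curve [(1, a, a^2, ...)]: its value at [v] is the
    polynomial with coefficients [v] evaluated at [a]. *)
Lemma generic_functional d (vs : seq 'rV[R]_d) :
  (forall v, v \in vs -> v != 0) ->
  exists c : 'cV[R]_d, forall v, v \in vs -> v *m c != 0.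
Proof.
move=> vs0; have [p /mapP[v /vs0 v0 ->]|a aP] := @common_nonroot (map rVpoly vs).
  by apply: contra v0 => /eqP h; rewrite -(rVpolyK v) h linear0.
exists (\col_i a ^+ i) => v vin; have := aP _ (map_f _ vin).
apply: contra => /eqP /matrixP /(_ 0 0); rewrite !mxE => h.
rewrite /rVpoly horner_poly -[X in _ == X]h; apply/eqP/eq_bigr => i _.
by rewrite mxE insubT // => di; congr (v 0 _ * _); apply: val_inj.
Qed.

(* Columns are chosen one at a time, each cutting every nonzero member of the
   family by one dimension. *)
Lemma generic_functionals d (vs : seq 'rV[R]_d) (F : seq 'M[R]_d) k :
  (forall v, v \in vs -> v != 0) ->
  exists c : nat -> 'cV[R]_d,
    (forall v j, v \in vs -> (j < k)%N -> v *m c j != 0) /\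
    (forall V u, V \in F -> (\rank V <= k)%N -> (u <= V)%MS ->
       (forall j, (j < \rank V)%N -> u *m c j = 0) -> u = 0 :> 'rV_d).
Proof.
move=> vs0; elim: k F => [|k IH] F.
  exists (fun=> 0); split=> // V u _; rewrite leqn0 mxrank_eq0 => /eqP ->.
  by rewrite submx0 => /eqP.
(* Adding one nonzero vector from each nonzero [V] ensures that [c0] does not vanish identically on
   [V]. *)
have [w|c0 c0P] := @generic_functional _ (vs ++ [seq nz_row V | V <- F & V != 0]).
  rewrite mem_cat => /orP[/vs0 //|/mapP[V]].
  by rewrite mem_filter => /andP[V0 _] ->; rewrite nz_row_eq0.
(* The remaining functionals only have to separate the parts of the subspaces killed by [c0], whose
   ranks have dropped. *)
have [c [c1 c2]] := IH [seq (V :&: kermx c0)%MS | V <- F].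
exists (fun j => if j is j'.+1 then c j' else c0); split.
  by move=> v [|j] vin jk; [apply: c0P; rewrite mem_cat vin | apply: c1].
move=> V u VF rV uV uc; have [V0|V0] := eqVneq V 0.
  by move: uV; rewrite V0 submx0 => /eqP.
have rV0 : (0 < \rank V)%N by rewrite lt0n mxrank_eq0.
have uV' : (u <= V :&: kermx c0)%MS.
  by rewrite sub_capmx uV; apply/sub_kermxP; exact: (uc 0%N).
have rlt : (\rank (V :&: kermx c0) < \rank V)%N.
  rewrite ltn_neqAle mxrankS ?capmxSl // andbT.
  apply/negP => /eqP re; have := mxrank_leqif_sup (capmxSl V (kermx c0)).
  move/leqifP; case: ifP => [sV _|_]; last by rewrite re ltnn.
  have /negP[] : nz_row V *m c0 != 0.
    by apply: c0P; rewrite mem_cat map_f ?orbT // mem_filter V0.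
  have : (nz_row V <= kermx c0)%MS.
    by rewrite (submx_trans (nz_row_sub V)) // (submx_trans sV) ?capmxSr.
  by move/sub_kermxP => ->.
apply: (c2 (V :&: kermx c0)%MS) => //; first exact: (map_f (fun V => (V :&: kermx c0)%MS)).
  by rewrite -ltnS (leq_trans rlt).
by move=> j jr; apply: (uc j.+1); exact: leq_trans rlt.
Qed.

(** The generic functionals become the columns of a linear change of coordinates in which each [V]
    is determined by its first [\rank V] coordinates. Putting the full space into the family makes
    the matrix invertible. *)
Lemma generic_matrix d (vs : seq 'rV[R]_d) (F : seq 'M[R]_d) :
  (forall v, v \in vs -> v != 0) ->
  exists2 M : 'M[R]_d, M \in unitmx &
    (forall v j, v \in vs -> (v *m M) 0 j != 0) /\
    (forall V u, V \in F -> (u <= V)%MS ->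
       (forall j : 'I_d, (j < \rank V)%N -> (u *m M) 0 j = 0) -> u = 0 :> 'rV_d).
Proof.
move=> vs0; have [c [c1 c2]] := @generic_functionals d vs (1%:M :: F) d vs0.
have MP (u : 'rV[R]_d) (j : 'I_d) : (u *m \matrix_(i, j < d) c j i 0) 0 j = (u *m c j) 0 0.
  by rewrite !mxE; apply: eq_bigr => i _; rewrite mxE.
have c2' V u : V \in 1%:M :: F -> (u <= V)%MS ->
    (forall j : 'I_d, (j < \rank V)%N ->
      (u *m \matrix_(i, j < d) c j i 0) 0 j = 0) -> u = 0 :> 'rV_d.
  move=> VF uV uM; apply: (c2 V) => //; first exact: rank_leq_row.
  move=> j jr; have jd : (j < d)%N by rewrite (leq_trans jr) ?rank_leq_row.
  by have := uM (Ordinal jd) jr; rewrite MP /= => e; apply/matrixP => a b; rewrite !ord1 e mxE.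
exists (\matrix_(i, j) c j i 0).
  rewrite -row_free_unit -kermx_eq0; apply/rowV0P => u /sub_kermxP uM.
  by apply: (c2' 1%:M); rewrite ?mem_head ?submx1 // => j _; rewrite uM mxE.
split => [v j vin|V u VF]; last by apply: c2'; rewrite inE VF orbT.
rewrite MP; apply: contra (c1 v j vin (ltn_ord j)) => /eqP h.
by apply/eqP/matrixP => a b; rewrite !ord1 h mxE.
Qed.

(** Each proper subspace [V] is annihilated by a nonzero functional [nu], and [q] need only satisfy
    [nu q <> nu p]. For [q = (a, a^2, ...)] this says that [a] is not a root of [pol]. The exponents
    start at 1 so that the constant [nu p] cannot cancel a coefficient of [nu]. *)
Lemma generic_point d (s : seq ('M[R]_d * 'rV[R]_d)) :
  (forall Vp, Vp \in s -> (\rank Vp.1 < d)%N) ->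
  exists q : 'rV[R]_d, forall Vp, Vp \in s -> ~~ (q - Vp.2 <= Vp.1)%MS.
Proof.
move=> rs; pose nu (V : 'M[R]_d) : 'rV[R]_d := nz_row (cokermx V)^T.
have nuP Vp : Vp \in s -> nu Vp.1 != 0.
  move=> /rs rV; rewrite nz_row_eq0 trmx_eq0 -mxrank_eq0 mxrank_coker.
  by rewrite subn_eq0 -ltnNge.
pose pol (Vp : 'M[R]_d * 'rV[R]_d) : {poly R} :=
  'X * rVpoly (nu Vp.1) - ((Vp.2 *m (nu Vp.1)^T) 0 0)%:P.
have [_ /mapP[Vp Vps ->]|a aP] := @common_nonroot (map pol s).
  apply: contraNneq (nuP _ Vps) => pol0.
  rewrite -(rVpolyK (nu _)) (_ : rVpoly _ = 0) ?linear0 //.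
  apply/polyP => i; rewrite coef0; have /polyP /(_ i.+1) := pol0.
  by rewrite coefB coefXM coefC /= subr0 coef0.
exists (\row_i a ^+ i.+1) => Vp Vps; have := aP _ (map_f _ Vps); apply: contra.
rewrite submxE => /eqP h.
have : (\row_i a ^+ i.+1 - Vp.2) *m (nu Vp.1)^T = 0.
  have : (nu Vp.1 <= (cokermx Vp.1)^T)%MS by exact: nz_row_sub.
  by case/submxP => D ->; rewrite trmx_mul trmxK mulmxA h mul0mx.
move/eqP; rewrite mulmxBl subr_eq0 => /eqP /matrixP /(_ 0 0) e.
rewrite /pol hornerD hornerN hornerC hornerM hornerX -e subr_eq0; apply/eqP.
rewrite /rVpoly horner_poly mxE mulr_sumr; apply: eq_bigr => i _.
rewrite !mxE insubT // => di; rewrite exprS.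
rewrite (_ : Sub _ _ = i); last exact: val_inj.
by rewrite -mulrA [_ * a ^+ i]mulrC.
Qed.

End GeneralPosition.

(** * Flattening a cone *)

Lemma pair_continuous (X Y Z : topologicalType) (f : X -> Y) (g : X -> Z) :
  continuous f -> continuous g -> continuous (fun x => (f x, g x)).
Proof. move=> cf cg x; exact: (cvg_pair (cf x) (cg x)). Qed.

Lemma mulmxr_continuous (R : realType) d k (M : 'M[R]_(d, k)) :
  continuous (fun u : 'rV[R]_d => u *m M).
Proof.
apply: rV_continuous => i u; under eq_fun do rewrite mxE.
have c j : continuous (fun x : 'rV[R]_d => x 0 j * M j i).
  move=> x; apply: (continuousM (s := fun x : 'rV[R]_d => x 0 j) (t := fun=> M j i)).
    exact: coord_continuous.
  exact: cst_continuous.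
have cs s : continuous (fun x : 'rV[R]_d => \sum_(j <- s) x 0 j * M j i).
  elim: s => [|j s IH] x.
    by under eq_fun do rewrite big_nil; exact: cst_continuous.
  under eq_fun do rewrite big_cons.
  exact: (continuousD (c j x) (IH x)).
exact: cs.
Qed.

(** * Splitting the space into a plane and its complement *)

Section Coordinates.
Variables (R : realType) (d : nat).
Hypothesis d2 : (2 <= d)%N.

Definition join_coords (ab : 'rV[R]_2 * 'rV[R]_(d - 2)) : 'rV[R]_d :=
  castmx (erefl, subnKC d2) (row_mx ab.1 ab.2).

Definition split_coords (y : 'rV[R]_d) : 'rV[R]_2 * 'rV[R]_(d - 2) :=
  let y' := castmx (esym erefl, esym (subnKC d2)) y in (lsubmx y', rsubmx y').

Lemma join_coordsK : cancel join_coords split_coords.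
Proof. by move=> [a b]; rewrite /split_coords /join_coords castmxK row_mxKl row_mxKr. Qed.

Lemma split_coordsK : cancel split_coords join_coords.
Proof. by move=> y; rewrite /join_coords /split_coords /= hsubmxK castmxKV. Qed.

Lemma split_coords_continuous : continuous split_coords.
Proof.
by apply: pair_continuous; apply: rV_continuous => i;
  under eq_fun do rewrite mxE castmxE; exact: coord_continuous.
Qed.

Lemma join_coords_continuous : continuous join_coords.
Proof.
apply: rV_continuous => i; rewrite /join_coords.
under eq_fun do rewrite castmxE ord1 mxE; case: (fintype.split _) => j y.
  apply: (continuous_comp (f := fst) (g := fun a : 'rV[R]_2 => a 0 j)).
    exact: cvg_fst.
  exact: coord_continuous.
apply: (continuous_comp (f := snd) (g := fun b : 'rV[R]_(d - 2) => b 0 j)).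
  exact: cvg_snd.
exact: coord_continuous.
Qed.

Lemma join_coords_inj2 (a a' : 'rV[R]_2) (b b' : 'rV[R]_(d - 2)) :
  (forall i : 'I_d, (i < 2)%N -> join_coords (a, b) 0 i = join_coords (a', b') 0 i) -> a = a'.
Proof.
move=> E; apply/rowP => j; have jd : (j < d)%N := leq_trans (ltn_ord j) d2.
have := E (Ordinal jd) (ltn_ord j); rewrite !castmxE.
have -> : cast_ord (esym (subnKC d2)) (Ordinal jd) = lshift (d - 2) j by exact: val_inj.
by rewrite !row_mxEl !ord1.
Qed.

End Coordinates.

Section ConeUnknotting.
Variables (R : realType) (d : nat) (N : R) (gamma : R -> 'rV[R]_d).
Variables (q : 'rV[R]_d) (M : 'M[R]_d) (x : 'I_d) (tau : R -> R).
Hypotheses (d5 : (5 <= d)%N) (N0 : 0 < N).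
Hypotheses (cgamma : continuous gamma) (gammaN : gamma 0 = gamma N).
Hypotheses (ctau : continuous tau) (tauN : tau 0 = tau N).
Hypothesis Mu : M \in unitmx.
Hypothesis x2 : x = 2%N :> nat.

Definition cone_map (v : 'rV[R]_2) : 'rV[R]_d :=
  q + radius v *: (gamma (pseudo_angle N v) - q).

(** Each of the three injectivity hypotheses permits one shear: forgetting the last coordinate,
    forgetting also the one before it once the radius is recorded, and keeping only [x] once [tau]
    is recorded as well. *)
Hypothesis inj_cone : forall (v w : 'rV[R]_2),
  (forall j : 'I_d, (j < d.-1)%N ->
    ((cone_map v - q) *m M) 0 j = ((cone_map w - q) *m M) 0 j) -> v = w.
Hypothesis inj_curve : forall s t, 0 <= s < N -> 0 <= t < N ->
  (forall j : 'I_d, (j < d - 2)%N ->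
    ((gamma s - q) *m M) 0 j = ((gamma t - q) *m M) 0 j) -> s = t.
Hypothesis inj_tau : forall s t, 0 <= s < N -> 0 <= t < N -> tau s = tau t ->
  ((gamma s - q) *m M) 0 x = ((gamma t - q) *m M) 0 x -> s = t.

Lemma disk_compact : compact (@disk R).
Proof.
apply: bounded_closed_compact.
  exists 1; split; first exact: num_real.
  move=> y y1 v /= dv; apply: le_trans (ltW y1).
  rewrite [leLHS]/Num.norm /= mx_normrE; apply/bigmax_leP; split=> //= -[i j] _ /=.
  have h (t : R) : t ^+ 2 <= 1 -> `|t| <= 1.
    by move=> t1; rewrite -(@expr_le1 _ 2) // real_normK ?num_real.
  move: (dv); rewrite /disk /= (ord1 i) => dv'.
  have [s0 s1] := (sqr_ge0 (v 0 0), sqr_ge0 (v 0 1)).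
  apply: h; case: j => -[|[|//]] j2.
    by rewrite (_ : Ordinal j2 = 0); [lra | exact: val_inj].
  by rewrite (_ : Ordinal j2 = 1); [lra | exact: val_inj].
have -> : @disk R = (@radius R) @^-1` [set r | r <= 1].
  by apply/seteqP; split => v /diskE.
by apply: closed_comp => [v _|]; [exact: radius_continuous | exact: closed_le].
Qed.

(** An affine change of coordinates is followed by four shears, through [e1], [e2] and [e3]. The
    bound on [d] keeps the coordinates 0 and 1 of [h], the coordinate [x] and the last two all
    distinct. *)
Lemma cone_unknotting (h : 'rV[R]_2 -> 'rV[R]_2) :
  continuous h -> set_inj disk h ->
  ambient_equiv disk cone_map
    (fun v => join_coords (ltnW (ltnW (ltnW d5))) (h v, 0)).
Proof.
move=> ch ih; set d2 := ltnW _.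
pose hh v := join_coords d2 (h v, 0).
pose e0 v := (cone_map v - q) *m M.
pose e1 v : 'rV[R]_d := \row_i (if i == d.-1 :> nat then radius v else e0 v 0 i).
pose e2 v : 'rV[R]_d := \row_i (if i == d.-2 :> nat
  then radius v * tau (pseudo_angle N v) else e1 v 0 i).
pose I3 (i : 'I_d) := (i == x) || (d.-2 <= i)%N.
pose e3 v : 'rV[R]_d := \row_i (if I3 i then e2 v 0 i else hh v 0 i).
have e0E v i : e0 v 0 i = radius v * ((gamma (pseudo_angle N v) - q) *m M) 0 i.
  by rewrite /e0 /cone_map addrC addKr -scalemxAl mxE.
have ce0 i : continuous (fun v => e0 v 0 i).
  under eq_fun do rewrite e0E.
  apply: (cone_continuous (f := fun s => ((gamma s - q) *m M) 0 i)) => //; last by rewrite gammaN.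
  apply: coord_continuous_comp => s.
  apply: (continuous_comp (f := fun s => gamma s - q) (g := fun y => y *m M));
    last exact: mulmxr_continuous.
  by apply: cvgB; [exact: cgamma | exact: cvg_cst].
have ce1 i : continuous (fun v => e1 v 0 i).
  under eq_fun do rewrite mxE; case: eqP => _; last exact: ce0.
  exact: radius_continuous.
have ce2 i : continuous (fun v => e2 v 0 i).
  under eq_fun do rewrite mxE; case: eqP => _; last exact: ce1.
  exact: cone_continuous.
have chh : continuous hh.
  move=> v; apply: (continuous_comp (f := fun v => (h v, 0 : 'rV[R]_(d - 2)))
    (g := join_coords d2)).
    by apply: pair_continuous v; [exact: ch | exact: cst_continuous].
  exact: join_coords_continuous.
have ce3 i : continuous (fun v => e3 v 0 i).
  under eq_fun do rewrite mxE; case: (I3 i); last exact: coord_continuous_comp.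
  exact: ce2.
have shear (I : pred 'I_d) e e' := @ambient_equiv_shear R _ d disk I e e' disk_compact.
have ilast : (d.-1 < d)%N by rewrite prednK // (leq_trans _ d5).
have iprev : (d.-2 < d)%N by lia.
have xd : (x < d.-2)%N by lia.
have -> : (fun v => join_coords d2 (h v, 0)) = hh by [].
apply: (@ambient_equiv_trans _ _ _ d _ _ _ e0).
  exists (fun y => (y - q) *m M), (fun y => y *m invmx M + q); split => //.
  - move=> y; have cT : {for y, continuous (fun y : 'rV[R]_d => y - q)}.
      apply: (continuousB (f := id) (g := fun=> q)); first exact: cvg_id.
      exact: cst_continuous.
    exact: (continuous_comp cT (@mulmxr_continuous _ _ _ M _)).
  - move=> y.
    exact: (continuousD (@mulmxr_continuous _ _ _ (invmx M) y)
      (@cst_continuous _ _ q y)).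
  - by move=> y; rewrite mulmxK // subrK.
  - by move=> y; rewrite addrK mulmxKV.
apply: (@ambient_equiv_trans _ _ _ d _ _ _ e1).
  apply: (shear (fun i => i != d.-1 :> nat)).
  - exact: rV_continuous.
  - exact: rV_continuous.
  - by move=> v i /negbTE id1; rewrite [RHS]mxE id1.
  - move=> v w _ _ E; apply: inj_cone => j jd; apply: E.
    by rewrite neq_ltn jd.
(* The last coordinate now gives the radius; off the centre it can be divided out, and the first
   [d - 2] coordinates determine the point of the curve. *)
apply: (@ambient_equiv_trans _ _ _ d _ _ _ e2).
  apply: (shear (fun i => i != d.-2 :> nat)).
  - exact: rV_continuous.
  - exact: rV_continuous.
  - by move=> v i /negbTE id2; rewrite [RHS]mxE id2.
  - move=> v w _ _ E.
    have r : radius v = radius w.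
      by have := E (Ordinal ilast); rewrite !mxE /= eqxx => ->//; lia.
    apply: (polar_eq N0) => // r0; apply: inj_curve; rewrite ?pseudo_angle_itv // => j jd.
    apply: (mulfI r0); rewrite -{1}r -!e0E.
    have j1 : (j == d.-1 :> nat) = false by lia.
    by have := E j; rewrite !mxE j1; apply; lia.
(* The radius, [tau] and the coordinate [x] already determine the point, so all other coordinates
   are free to be replaced. *)
apply: (@ambient_equiv_trans _ _ _ d _ _ _ e3).
  apply: (shear I3).
  - exact: rV_continuous.
  - exact: rV_continuous.
  - by move=> v i Ii; rewrite [RHS]mxE Ii.
  - move=> v w _ _ E.
    have r : radius v = radius w.
      have := E (Ordinal ilast); rewrite !mxE /= eqxx.
      have -> : (d.-1 == d.-2) = false by lia.
      by apply; rewrite /I3 /=; lia.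
    apply: (polar_eq N0) => // r0; apply: inj_tau; rewrite ?pseudo_angle_itv //.
      apply: (mulfI r0); rewrite -{1}r.
      have := E (Ordinal iprev); rewrite !mxE /= eqxx; apply.
      by rewrite /I3 /= leqnn orbT.
    apply: (mulfI r0); rewrite -{1}r -!e0E.
    have := E x; rewrite !mxE.
    have -> : (x == d.-2 :> nat) = false by lia.
    have -> : (x == d.-1 :> nat) = false by lia.
    by apply; rewrite /I3 eqxx.
(* Coordinates 0 and 1 carry the injective map [h], so the three coordinates of [I3] can be set to
   0. *)
apply: (shear (predC I3)).
- exact: rV_continuous.
- exact: chh.
- by move=> v i /negbTE Ii; rewrite mxE Ii.
- move=> v w Dv Dw E; apply: (ih v w (mem_set Dv) (mem_set Dw)).
  apply: (join_coords_inj2 (d2 := d2) (b := 0) (b' := 0)) => i i2.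
  have I3i : I3 i = false.
    apply/negbTE; rewrite /I3 negb_or -ltnNge -(inj_eq val_inj) /= x2; lia.
  by have := E i; rewrite !mxE /= I3i; apply.
Qed.

End ConeUnknotting.

(** * Separating double points of a linear coordinate *)

Lemma max_gap (R : realType) (a : nat -> R) n :
  (forall k, (0 < k < n)%N -> a k < a 0%N) ->
  exists2 delta, 0 < delta & forall k, (0 < k < n)%N -> delta <= a 0%N - a k.
Proof.
elim: n => [_|n IH amax]; first by exists 1 => // k; rewrite ltn0 andbF.
have [|d d0 dP] := IH; first by move=> k /andP[k0 kn]; apply: amax; rewrite k0 ltnW.
have [n0|n0] := posnP n; first by exists d => // k; lia.
exists (Num.min d (a 0%N - a n)).
  by rewrite lt_min d0 subr_gt0 amax // n0 ltnSn.
move=> k /andP[k0]; rewrite ltnS leq_eqVlt => /predU1P[->|kn].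
  by rewrite ge_min lexx orbT.
by rewrite ge_min dP // k0.
Qed.

(* tau climbs slowly until shortly before n and then falls back to 0 while xi
   is above all its vertex values other than a 0. *)
Lemma separating_function (R : realType) (n : nat) (a : nat -> R) (xi : R -> R) :
  (1 < n)%N ->
  (forall k r, (k < n)%N -> 0 <= r <= 1 ->
    xi (k%:R + r) = (1 - r) * a k + r * a k.+1) ->
  a n = a 0%N -> (forall k, (0 < k < n)%N -> a k < a 0%N) ->
  exists tau : R -> R, [/\ continuous tau, tau 0 = tau n%:R &
    forall s t, 0 <= s < n%:R -> 0 <= t < n%:R -> tau s = tau t ->
      xi s = xi t -> s = t].
Proof.
case: n => [|[|m]] // _; set n := m.+2 => xiE an amax.
have [delta delta0 gap] := max_gap amax.
pose L0 := a 0%N - a m.+1.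
have L0d : delta <= L0 by apply: gap; rewrite /n /=.
have n2 : 2 <= n%:R :> R by rewrite ler_nat.
(* The slope of the falling branch is so large that a falling point [t] with [tau t < n] satisfies
   [(n - t) * L0 < delta], as [Lamd] shows. *)
pose Lam : R := n%:R * L0 / delta + n%:R.
have Lamd : Lam * delta = n%:R * (L0 + delta).
  by rewrite /Lam; field; rewrite gt_eqF.
have Lamn : n%:R <= Lam by rewrite lerDr !mulr_ge0 ?invr_ge0 //; lra.
(* A collision between [s] on the rising branch and [t] on the falling one. Here [t] lies on the
   last edge, where [xi] has the value [a 0 - u * L0]. *)
have core s t : 0 <= s < n%:R -> 0 <= t < n%:R -> s = Lam * (n%:R - t) ->
    xi s = xi t -> s = t.
  move=> hs /andP[t0 tn] st.
  pose u := n%:R - t; have u0 : 0 < u by rewrite /u; lra.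
  have us : s = Lam * u by [].
  have s0 : 0 < s by rewrite us mulr_gt0 //; lra.
  have u1 : u < 1.
    rewrite ltNge; apply/negP => u1; have : Lam * 1 <= Lam * u.
      by rewrite ler_pM2l //; lra.
    by move/andP: hs => [_]; rewrite us mulr1; lra.
  have -> : xi t = a 0%N - u * L0.
    have -> : t = m.+1%:R + (1 - u) by rewrite /u /n -[m.+2%:R]natr1; ring.
    rewrite xiE //; last by apply/andP; split; lra.
    by rewrite an /L0; ring.
  have [k [r [kn /andP[r0 r1] sE]]] := nat_frac_part hs.
  rewrite {1}sE xiE //; last by rewrite r0 ltW.
  (* If [s] is also on the last edge, [xi] is strictly monotone there and [s = t]. On every other
     edge [xi s] is strictly below [xi t]. *)
  have [k1|k1] := eqVneq k m.+1.
    rewrite k1 an => E; have ru : 1 - r = u.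
      by apply: (@mulIf _ L0); [rewrite gt_eqF //; lra | rewrite /L0 in E *; lra].
    by rewrite sE k1; move: ru; rewrite /u /n -[m.+2%:R]natr1; lra.
  have kn1 : (k < m.+1)%N by rewrite ltn_neqAle k1.
  have g1 : delta <= a 0%N - a k.+1 := gap k.+1 kn1.
  have sn : s < n%:R by case/andP: hs.
  case: k k1 kn sE kn1 g1 => [|k] k1 kn sE kn1 g1 E; exfalso.
    (* On the first edge [xi] has dropped by at least [s * delta], and [s = Lam * u] makes this more
       than [u * L0]. *)
    have rs : r = s by rewrite sE add0r.
    have : u * L0 < s * delta.
      rewrite us -mulrA (mulrC u delta) mulrA Lamd mulrC ltr_pM2r //.
      apply: (lt_le_trans (y := 2 * (L0 + delta))); first lra.
      by rewrite ler_pM2r //; lra.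
    have : s * delta <= s * (a 0%N - a 1%N) by rewrite ler_pM2l.
    by rewrite rs in E; lra.
  (* On a middle edge both end values lie at least [delta] below [a 0], whereas [xi t] is less than
     [delta] below it. *)
  have g0 : delta <= a 0%N - a k.+1 := gap k.+1 kn.
  have uL : u * L0 < delta.
    have Lam0 : 0 < Lam by lra.
    rewrite -(ltr_pM2l Lam0) mulrA -us Lamd.
    have sL : s * L0 <= n%:R * L0 by rewrite ler_wpM2r //; lra.
    have nd : 0 < n%:R * delta by rewrite mulr_gt0 //; lra.
    apply: le_lt_trans sL _; by rewrite [ltRHS]mulrDr ltrDl.
  have r1' : 0 <= 1 - r by lra.
  have := ler_wpM2l r1' g0; have := ler_wpM2l r0 g1.
  by lra.
exists (fun s => Num.min s (Lam * (n%:R - s))); split.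
- move=> s; apply: (continuous_min (f := id : R -> R^o) (g := fun s => Lam * (n%:R - s) : R^o)).
    exact: cvg_id.
  apply: cvgM; first exact: cvg_cst.
  by apply: cvgB; [exact: cvg_cst | exact: cvg_id].
- rewrite subr0 subrr mulr0; transitivity (0 : R); [apply/min_idPl | apply/esym/min_idPr].
    by rewrite mulr_ge0 //; lra.
  lra.
move=> s t hs ht; have Lam0 : Lam != 0 by rewrite gt_eqF //; lra.
rewrite /Num.min; case: ifP => _; case: ifP => _ E xiE'.
- by [].
- exact: core.
- by apply/esym/core.
- by move/(mulfI Lam0): E; lra.
Qed.

(** * Cones over polygons *)

Section Hull.
Variables (R : realType) (d : nat).
Local Notation E := 'rV[R]_d.
Implicit Types (A B : {fset E}) (x y a b : E).

Lemma hull_mono A B : (A `<=` B)%fset -> hull A `<=` hull B.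
Proof.
move=> AB x [w [w0 w1 ->]].
have H (V : nmodType) (F : E -> V) : \sum_(v <- A) F v = \sum_(v <- B) (if v \in A then F v else 0).
  rewrite -(big_fset_incl _ AB) => [|v _ /negbTE ->//].
  by apply: eq_big_seq => v ->.
exists (fun v => if v \in A then w v else 0); split.
- by move=> v _; case: ifP => // /w0.
- by rewrite -H.
- by rewrite H; apply: eq_bigr => v _; case: ifP => //; rewrite scale0r.
Qed.

Lemma hull1 a : hull [fset a]%fset = [set a].
Proof.
apply/seteqP; split => [x [w [_]]|_ ->]; rewrite ?big_seq_fset1.
  by move=> -> ->; rewrite scale1r.
by exists (fun=> 1); rewrite !big_seq_fset1 scale1r; split.
Qed.

Lemma hull_vertex A a : a \in A -> hull A a.
Proof. by move=> aA; apply: (@hull_mono [fset a]%fset); rewrite ?fsub1set ?hull1. Qed.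

Lemma hull_convex A x y s : hull A x -> hull A y -> 0 <= s <= 1 ->
  hull A ((1 - s) *: x + s *: y).
Proof.
move=> [w [w0 w1 ->]] [u [u0 u1 ->]] /andP[s0 s1].
exists (fun v => (1 - s) * w v + s * u v); split.
- by move=> v vA; rewrite addr_ge0 ?mulr_ge0 ?subr_ge0 ?w0 ?u0.
- by rewrite big_split /= -!mulr_sumr w1 u1 !mulr1 subrK.
- rewrite !scaler_sumr -big_split /=; apply: eq_bigr => v _.
  by rewrite [RHS]scalerDl !scalerA.
Qed.

(** The weights on [B] are normalized by their total mass [s]. If [s = 0] this is impossible, and
    the point [b] serves as the irrelevant second end. *)
Lemma hull_fset1UP a b B x : a \notin B -> b \in B -> hull (a |` B)%fset x <->
  exists s y, [/\ 0 <= s <= 1, hull B y & x = (1 - s) *: a + s *: y].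
Proof.
move=> aB bB; split => [[w [w0]]|[s [y [s01 hy ->]]]]; last first.
  apply: hull_convex => //; first by apply: hull_vertex; rewrite !inE eqxx.
  by apply: hull_mono hy; exact: fsubsetUr.
rewrite !big_fsetU1 //=; set s := \sum_(v <- B) w v => w1 ->.
have wB v : v \in B -> 0 <= w v by move=> vB; apply: w0; rewrite !inE vB orbT.
have s0 : 0 <= s by rewrite /s big_seq; apply: sumr_ge0.
have wa : w a = 1 - s by rewrite -w1 addrK.
have s1 : s <= 1 by rewrite -subr_ge0 -wa; apply: w0; rewrite !inE eqxx.
have [s00|sn0] := eqVneq s 0.
  exists 0, b; split; rewrite ?lexx ?ler01 //; first exact: hull_vertex.
  have wz v : v \in B -> w v = 0.
    move=> vB; apply/eqP; rewrite eq_le wB // andbT -s00 /s.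
    rewrite (big_fsetD1 v) //= lerDl big_seq; apply: sumr_ge0 => u.
    by rewrite in_fsetD1 => /andP[_ /wB].
  rewrite wa s00 scale0r; congr (_ + _).
  by rewrite big_seq big1 // => v /wz ->; rewrite scale0r.
exists s, (\sum_(v <- B) (s^-1 * w v) *: v); split; first by rewrite s0.
  exists (fun v => s^-1 * w v); split => //.
    by move=> v vB; rewrite mulr_ge0 ?invr_ge0 ?wB.
  by rewrite -mulr_sumr mulVf.
rewrite wa scaler_sumr; congr (_ + _); apply: eq_bigr => v _.
by rewrite scalerA mulrA divff // mul1r.
Qed.

Lemma hull_fset2P a b x : a != b -> hull [fset a; b]%fset x <->
  exists2 s, 0 <= s <= 1 & x = (1 - s) *: a + s *: b.
Proof.
move=> ab; rewrite (hull_fset1UP _ (b := b)) ?inE //.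
split => [[s [y [s01]]]|[s s01 ->]]; first by rewrite hull1 => -> ->; exists s.
by exists s, b; rewrite hull1.
Qed.

End Hull.

(** * The cone from an apex in general position *)

Section ConeComplex.
Variables (R : realType) (d n : nat) (P : 'I_n -> 'rV[R]_d).
Hypothesis hP : simple_polygon P.

Definition edge_point i (s : R) : 'rV[R]_d := (1 - s) *: P i + s *: P (ordS i).

(** The direction space of the affine span of the edges [i] and [j], with [P i] as base point. *)
Definition edge_span (i j : 'I_n) : 'M[R]_d :=
  (<<P (ordS i) - P i>> + <<P (ordS j) - P j>> + <<P j - P i>>)%MS.

Lemma rank_edge_span i j : (\rank (edge_span i j) <= 3)%N.
Proof.
have r1 (u : 'rV[R]_d) : (\rank <<u>> <= 1)%N by rewrite genmxE rank_leq_row.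
apply: (leq_trans (mxrank_adds_leqif _ _)); rewrite -[3%N]/(2 + 1)%N leq_add //.
by apply: (leq_trans (mxrank_adds_leqif _ _)); rewrite -[2%N]/(1 + 1)%N leq_add.
Qed.

Lemma edge_pointB i s : edge_point i s - P i = s *: (P (ordS i) - P i).
Proof. by apply/rowP => k; rewrite /edge_point !mxE; ring. Qed.

Lemma edge_point_span1 i j s : (edge_point i s - P i <= edge_span i j)%MS.
Proof.
rewrite edge_pointB scalemx_sub // /edge_span.
apply: submx_trans (addsmxSl _ _); apply: submx_trans (addsmxSl _ _).
by rewrite genmxE.
Qed.

Lemma edge_point_span2 i j s : (edge_point j s - P i <= edge_span i j)%MS.
Proof.
rewrite -(subrKA (P j)) edge_pointB addmx_sub //; last first.
  by rewrite (submx_trans _ (addsmxSr _ _)) // genmxE.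
rewrite scalemx_sub // (submx_trans _ (addsmxSl _ _)) //.
by rewrite (submx_trans _ (addsmxSr _ _)) // genmxE.
Qed.

Lemma edge_pointB_span i j s t : (edge_point i s - edge_point j t <= edge_span i j)%MS.
Proof.
rewrite -(subrKA (P i)) addmx_sub ?edge_point_span1 //.
by rewrite -opprB eqmx_opp edge_point_span2.
Qed.

Lemma edge_point0 i : edge_point i 0 = P i.
Proof. by rewrite /edge_point subr0 scale1r scale0r addr0. Qed.

Lemma edge_point1 i : edge_point i 1 = P (ordS i).
Proof. by rewrite /edge_point subrr scale1r scale0r add0r. Qed.

Lemma edge_point_inj i j s t : 0 <= s < 1 -> 0 <= t < 1 ->
  edge_point i s = edge_point j t -> i = j /\ s = t.
Proof. by case: hP => _; apply. Qed.

Lemma vertex_inj : injective P.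
Proof.
move=> i j E; have [|||//] := @edge_point_inj i j 0 0; rewrite ?lexx ?ltr01 //.
by rewrite !edge_point0.
Qed.

Lemma ordS_neq (i : 'I_n) : ordS i != i.
Proof.
apply/eqP => E; have [] := @edge_point_inj i i 0 (1 / 2); rewrite ?lexx ?ltr01 //.
- by apply/andP; split; lra.
- by rewrite /edge_point E -!scalerDl !subrK.
- by move=> _ /eqP; rewrite eq_sym mulf_eq0 oner_eq0 invr_eq0 pnatr_eq0.
Qed.

Lemma edge_neq i : P i != P (ordS i).
Proof. by rewrite (inj_eq vertex_inj) eq_sym ordS_neq. Qed.

(** The midpoint depends only on the unordered pair of end points, and it lies on a single edge. *)
Lemma polygon_edge_inj : injective (polygon_edge P).
Proof.
move=> i j E.
have h : edge_point i (1 / 2) = edge_point j (1 / 2).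
  have H k : edge_point k (1 / 2) = (1 / 2) *: \sum_(v <- polygon_edge P k) v.
    rewrite big_fsetU1 ?inE ?edge_neq //= big_seq_fset1 /edge_point scalerDr.
    by congr (_ *: _ + _); field.
  by rewrite !H E.
by have [] // := edge_point_inj _ _ h; apply/andP; split; lra.
Qed.

(** Simplicity speaks of half-open edges, so a parameter 1 is first turned into the parameter 0 of
    the next edge. *)
Lemma edge_point_meet i j s t : 0 <= s <= 1 -> 0 <= t <= 1 -> i != j ->
  edge_point i s = edge_point j t ->
  edge_point i s \in (polygon_edge P i `&` polygon_edge P j)%fset.
Proof.
move=> /andP[s0 s1] /andP[t0 t1] ij E.
have z : 0 <= (0 : R) < 1 by rewrite lexx ltr01.
rewrite inE {2}E !in_fset2; move: s1; rewrite le_eqVlt => /predU1P[s1|s1].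
  rewrite s1 edge_point1 eqxx orbT /=.
  move: t1; rewrite le_eqVlt => /predU1P[t1|t1].
    by rewrite t1 edge_point1 eqxx orbT.
  rewrite s1 edge_point1 -edge_point0 in E.
  have [_ t00] := edge_point_inj z (introT andP (conj t0 t1)) E.
  by rewrite -t00 edge_point0 eqxx.
move: t1; rewrite le_eqVlt => /predU1P[t1|t1].
  rewrite [in edge_point j t]t1 edge_point1 eqxx orbT andbT.
  rewrite t1 edge_point1 -edge_point0 in E.
  have [_ s00] := edge_point_inj (introT andP (conj s0 s1)) z E.
  by rewrite s00 edge_point0 eqxx.
by have [e] := edge_point_inj (introT andP (conj s0 s1)) (introT andP (conj t0 t1)) E;
  rewrite e eqxx in ij.
Qed.

Lemma hull_polygon_edge i x : hull (polygon_edge P i) x <->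
  exists2 s, 0 <= s <= 1 & x = edge_point i s.
Proof. exact: hull_fset2P (edge_neq i). Qed.

Variable q : 'rV[R]_d.
Hypothesis qP : forall i j, ~~ (q - P i <= edge_span i j)%MS.

Definition cone_triangle i : {fset 'rV[R]_d} := (q |` polygon_edge P i)%fset.

(** If [r] and [r'] differed, dividing by [r - r'] would put the apex into the affine span of the
    two edges. *)
Lemma cone_edge_inj i j r r' s t :
  r *: (edge_point i s - q) = r' *: (edge_point j t - q) ->
  r = r' /\ (r = 0 \/ edge_point i s = edge_point j t).
Proof.
move=> E; have rr : r = r'.
  apply/eqP/negPn/negP; rewrite -subr_eq0 => rr; have /negP := qP i j; apply.
  rewrite -(eqmx_scale _ rr).
  have -> : (r - r') *: (q - P i) = r *: (edge_point i s - P i) - r' *: (edge_point j t - P i).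
    rewrite -[edge_point i s - P i](subrKA q) -[edge_point j t - P i](subrKA q).
    by rewrite (scalerDr r) (scalerDr r') E opprD addrACA subrr add0r -scalerBl.
  by rewrite addmx_sub ?scalemx_sub ?edge_point_span1 // eqmx_opp scalemx_sub ?edge_point_span2.
split=> //; rewrite -{}rr in E.
have [->|r0] := eqVneq r 0; [by left | right].
by move/(scalerI r0): E; exact: addIr.
Qed.

Lemma apex_notin_edge i : q \notin polygon_edge P i.
Proof.
apply/negP; rewrite in_fset2 => /orP[] /eqP qE; have /negP := qP i i; apply.
  by rewrite qE subrr sub0mx.
by rewrite qE -edge_point1 edge_point_span1.
Qed.

Lemma hull_cone_triangle i x : hull (cone_triangle i) x <->
  exists r s, [/\ 0 <= r <= 1, 0 <= s <= 1 & x = q + r *: (edge_point i s - q)].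
Proof.
rewrite (hull_fset1UP _ (b := P i)) ?apex_notin_edge ?in_fset2 ?eqxx //.
have H r y : (1 - r) *: q + r *: y = q + r *: (y - q).
  by rewrite scalerBl scale1r scalerBr addrAC addrA.
split=> [[r [y [r01 /hull_polygon_edge [s s01 ->] ->]]]|[r [s [r01 s01 ->]]]].
  by exists r, s; rewrite H.
exists r, (edge_point i s); rewrite H; split => //.
by apply/hull_polygon_edge; exists s.
Qed.

End ConeComplex.

(** * The triangulation of the cone and its boundary edges *)

Section ConeTriangulation.
Variables (R : realType) (d n : nat) (P : 'I_n -> 'rV[R]_d) (q : 'rV[R]_d).
Hypothesis hP : simple_polygon P.
Hypothesis qP : forall i j, ~~ (q - P i <= edge_span P i j)%MS.

Definition cone_complex : {fset {fset 'rV[R]_d}} :=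
  [fset cone_triangle P q i | i in 'I_n]%fset.

Lemma cone_complexP t :
  reflect (exists i, t = cone_triangle P q i) (t \in cone_complex).
Proof.
apply: (iffP (imfsetP _ _ _ _)) => [[i _ ->]|[i ->]]; first by exists i.
by exists i.
Qed.

Lemma edge_sub_cone_triangle i j :
  (polygon_edge P i `<=` cone_triangle P q j)%fset -> i = j.
Proof.
move=> /fsubsetP sub; apply: (polygon_edge_inj hP); apply/eqP.
rewrite eqEfcard !cardfs2 !(edge_neq hP) leqnn andbT; apply/fsubsetP => v vi.
have := sub v vi; rewrite in_fset1U => /predU1P[vq|//].
by move: vi; rewrite vq (negbTE (apex_notin_edge qP i)).
Qed.

Lemma cone_triangle_inj : injective (cone_triangle P q).
Proof.
by move=> i j E; apply: edge_sub_cone_triangle; rewrite -E fsubsetUr.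
Qed.

Lemma card_cone_complex : #|` cone_complex|%fset = n.
Proof.
rewrite card_imfset; last exact: cone_triangle_inj.
by rewrite -cardE card_ord.
Qed.

Lemma card_cone_triangle i : #|` cone_triangle P q i|%fset = 3%N.
Proof. by rewrite cardfsU1 (apex_notin_edge qP) cardfs2 (edge_neq hP). Qed.

(** A nonzero weight on [q] would place it on the line of the edge; then a nonzero weight on an end
    point would collapse the edge. *)
Lemma affinely_independent_cone_triangle i :
  affinely_independent (cone_triangle P q i).
Proof.
have qE := apex_notin_edge qP i.
have PE : P i \notin [fset P (ordS i)]%fset by rewrite inE (edge_neq hP).
move=> w; rewrite !big_fsetU1 //= !big_seq_fset1.
set a := P i; set b := P (ordS i) => w0 wv0.
have wa : w a = - w q - w b by rewrite -[LHS]addr0 -oppr0 -w0; ring.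
have E : w q *: (q - a) = - w b *: (b - a).
  apply/eqP; rewrite -subr_eq0 -wv0 wa !scalerBr !scalerBl !scaleNr.
  rewrite !opprB !opprK; apply/eqP/rowP => k; rewrite !mxE; ring.
have wq : w q = 0.
  apply/eqP/negPn/negP => wq; have /negP := qP i i; apply.
  rewrite -(eqmx_scale _ wq) E scalemx_sub //.
  by rewrite /b -edge_point1 edge_point_span1.
have wb : w b = 0.
  move/eqP: E; rewrite wq scale0r eq_sym scaler_eq0 oppr_eq0 subr_eq0.
  by rewrite [b == a]eq_sym (negbTE (edge_neq hP i)) orbF => /eqP.
move=> v; rewrite in_fset1U in_fset2 => /predU1P[->//|/orP[] /eqP -> //].
by rewrite -/a wa wq wb oppr0 addr0.
Qed.

(** A common point of two triangles is the apex or lies over a common point of the two edges. The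
    latter is a shared vertex, so the point is on the segment from the apex to it. *)
Lemma triangle_complex_cone : triangle_complex cone_complex.
Proof.
split=> [t /cone_complexP [i ->]|_ _ /cone_complexP[i ->] /cone_complexP[j ->]].
  split; [exact: card_cone_triangle | exact: affinely_independent_cone_triangle].
have [->|ij] := eqVneq i j; first by rewrite setIid fsetIid.
apply/seteqP; split => x; last first.
  by move=> h; split; apply: hull_mono h; rewrite ?fsubsetIl ?fsubsetIr.
case=> /(hull_cone_triangle hP qP) [r [s [r01 s01 ->]]].
move=> /(hull_cone_triangle hP qP) [r' [s' [_ s'01 /addrI E]]].
have qI : q \in (cone_triangle P q i `&` cone_triangle P q j)%fset.
  by rewrite in_fsetI !in_fset1U eqxx.
have [_ [->|e]] := cone_edge_inj qP E.
  by rewrite scale0r addr0; exact: hull_vertex.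
have := edge_point_meet hP s01 s'01 ij e; rewrite in_fsetI => /andP[pi pj].
have -> : q + r *: (edge_point P i s - q) = (1 - r) *: q + r *: edge_point P i s.
  by rewrite scalerBl scale1r scalerBr addrAC addrA.
apply: hull_convex => //; first exact: hull_vertex.
apply: hull_vertex; rewrite in_fsetI /cone_triangle.
by apply/andP; split; apply: fset1Ur.
Qed.

(** An edge through the apex joins it to a vertex [v] and lies in both triangles next to [v]; an
    edge avoiding the apex is a polygon edge and lies in one triangle only. *)
Lemma boundary_edges_cone : boundary_edges cone_complex = polygon_edges P.
Proof.
apply/seteqP; split => [e [e2 [t [[/cone_complexP [i ->] sub] uniq_t]]]|_ [i ->]].
  have [qe|qe] := boolP (q \in e); last first.
    exists i; apply/eqP; rewrite eqEfcard e2 cardfs2 (edge_neq hP) andbT.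
    apply/fsubsetP => v ve; have := fsubsetP sub v ve.
    by rewrite in_fset1U => /predU1P[vq|//]; rewrite -vq ve in qe.
  have other j : j != i -> ~ (e `<=` cone_triangle P q j)%fset.
    move=> ji ej; have /cone_triangle_inj ij : cone_triangle P q i = cone_triangle P q j.
      by apply: uniq_t; split=> //; apply/cone_complexP; exists j.
    by rewrite ij eqxx in ji.
  have : #|` (e `\ q)%fset|%fset == 1%N by have := cardfsD1 q e; rewrite qe e2 add1n => -[<-].
  case/cardfs1P => v /fsetP ev.
  have /andP[vq ve] : (v != q) && (v \in e) by rewrite -in_fsetD1 ev inE.
  have eP j : v \in polygon_edge P j -> (e `<=` cone_triangle P q j)%fset.
    move=> vj; apply/fsubsetP => u ue; rewrite in_fset1U.
    have [//|uq] := eqVneq u q; have := ev u; rewrite in_fsetD1 uq ue inE.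
    by move/esym/eqP => ->.
  have := fsubsetP sub v ve; rewrite in_fset1U (negbTE vq) orFb in_fset2 => /orP[] /eqP vE.
    exfalso; apply: (other (ord_pred i)).
      by rewrite -(inj_eq (@ordS_inj n)) ord_predK eq_sym (ordS_neq hP).
    by apply: eP; rewrite in_fset2 ord_predK vE eqxx orbT.
  exfalso; apply: (other (ordS i)); first exact: (ordS_neq hP).
  by apply: eP; rewrite in_fset2 vE eqxx.
split; first by rewrite cardfs2 (edge_neq hP).
exists (cone_triangle P q i); split.
  by split; [apply/cone_complexP; exists i | exact: fsubsetUr].
by move=> _ [/cone_complexP [j ->] /edge_sub_cone_triangle ->].
Qed.

Lemma carrier_coneP x : carrier cone_complex x <->
  exists i r s, [/\ 0 <= r <= 1, 0 <= s <= 1 & x = q + r *: (edge_point P i s - q)].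
Proof.
split=> [[t /= /cone_complexP [i ->] /(hull_cone_triangle hP qP) [r [s H]]]|[i H]].
  by exists i, r, s.
exists (cone_triangle P q i); last exact/(hull_cone_triangle hP qP).
by apply/cone_complexP; exists i.
Qed.

Lemma polygon_curveP x : polygon_curve P x <->
  exists i s, 0 <= s <= 1 /\ x = edge_point P i s.
Proof.
split=> [[_ [i ->] /(hull_polygon_edge hP) [s s01 ->]]|[i [s [s01 ->]]]].
  by exists i, s.
by exists (polygon_edge P i); [exists i | apply/(hull_polygon_edge hP); exists s].
Qed.

End ConeTriangulation.

(** * Parametrized cones over polygons *)

Section PolygonCone.
Variables (R : realType) (d n : nat) (P : 'I_n -> 'rV[R]_d).
Hypotheses (d5 : (5 <= d)%N) (hP : simple_polygon P).

Lemma iter_ordS (i : 'I_n) k : nat_of_ord (iter k (@ordS n) i) = ((i + k) %% n)%N.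
Proof.
elim: k => [|k IH]; first by rewrite addn0 modn_small.
by rewrite iterS /= IH -addn1 modnDml addn1 addnS.
Qed.

Lemma iter_ordSn (i : 'I_n) : iter n (@ordS n) i = i.
Proof. by apply: val_inj; rewrite /= iter_ordS modnDr modn_small. Qed.

Lemma iter_ordS_inj (i : 'I_n) k l : (k < n)%N -> (l < n)%N ->
  iter k (@ordS n) i = iter l (@ordS n) i -> k = l.
Proof.
move=> kn ln /(congr1 val); rewrite /= !iter_ordS => /eqP.
by rewrite eqn_modDl !modn_small // => /eqP.
Qed.

Lemma iter_ordS_surj (i j : 'I_n) : exists2 k, (k < n)%N & iter k (@ordS n) i = j.
Proof.
have n0 : (0 < n)%N by exact: leq_ltn_trans (ltn_ord i).
exists ((j + (n - i)) %% n)%N; first by rewrite ltn_mod.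
apply: val_inj; rewrite /= iter_ordS modnDmr addnCA subnKC 1?ltnW //.
by rewrite modnDr modn_small.
Qed.

Lemma simple_polygon_gt1 : (1 < n)%N.
Proof.
case: (hP) => n0 _; rewrite ltn_neqAle n0 andbT; apply/eqP => n1.
have := ordS_neq hP (Ordinal n0); move: (ordS _) => j.
by rewrite -(inj_eq val_inj) /=; have := ltn_ord j; lia.
Qed.

(** The numbering starts at a freely chosen vertex [i], so that the parametrization can later begin
    where a linear coordinate is maximal. *)
Definition polygon_vertex (i : 'I_n) k : 'rV[R]_d := P (iter k (@ordS n) i).

Definition polygon_param (i : 'I_n) : R -> 'rV[R]_d :=
  piecewise_linear (polygon_vertex i) n.

Lemma polygon_param_edge i s : 0 <= s < n%:R ->
  exists k r, [/\ (k < n)%N, 0 <= r < 1, s = k%:R + r &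
    polygon_param i s = edge_point P (iter k (@ordS n) i) r].
Proof.
move=> /nat_frac_part [k [r [kn r01 ->]]]; exists k, r; split => //.
rewrite /polygon_param piecewise_linearE //.
by case/andP: r01 => -> /ltW.
Qed.

Lemma polygon_param_inj i s t : 0 <= s < n%:R -> 0 <= t < n%:R ->
  polygon_param i s = polygon_param i t -> s = t.
Proof.
move=> /(polygon_param_edge i) [k [r [kn r01 -> ->]]].
move=> /(polygon_param_edge i) [l [r' [ln r'01 -> ->]]].
by move=> /(edge_point_inj hP r01 r'01) [/(iter_ordS_inj kn ln) -> ->].
Qed.

Lemma polygon_param_surj i j r : 0 <= r <= 1 ->
  exists2 s, 0 <= s < n%:R & polygon_param i s = edge_point P j r.
Proof.
have main l t : 0 <= t < 1 ->
    exists2 s, 0 <= s < n%:R & polygon_param i s = edge_point P l t.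
  move=> /andP[t0 t1]; have [k kn <-] := iter_ordS_surj i l.
  exists (k%:R + t); last by rewrite /polygon_param piecewise_linearE // t0 ltW.
  rewrite addr_ge0 //=; have : k%:R + 1 <= n%:R :> R by rewrite natr1 ler_nat.
  lra.
move=> /andP[r0]; rewrite le_eqVlt => /predU1P[->|r1]; last first.
  by apply: main; rewrite r0.
by rewrite edge_point1 -edge_point0; apply: main; rewrite lexx ltr01.
Qed.

Lemma polygon_param_continuous i : continuous (polygon_param i).
Proof. by apply: rV_continuous => j; exact: piecewise_linear_continuous. Qed.

Lemma polygon_param_closed i : polygon_param i 0 = polygon_param i n%:R.
Proof.
have n0 : (0 < n)%N by case: hP.
rewrite /polygon_param piecewise_linear0 piecewise_linearn //.
by rewrite /polygon_vertex iter_ordSn.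
Qed.

Lemma generic_apex : exists q : 'rV[R]_d,
  forall i j, ~~ (q - P i <= edge_span P i j)%MS.
Proof.
have [|q qP] := @generic_point R d [seq (edge_span P i j, P i) | i <- enum 'I_n, j <- enum 'I_n].
  move=> _ /allpairsP [[i j] [_ _ ->]] /=.
  by rewrite (leq_ltn_trans (rank_edge_span P i j)) // (leq_trans _ d5).
exists q => i j; apply: (qP (edge_span P i j, P i)).
by apply/allpairsP; exists (i, j); rewrite !mem_enum.
Qed.

Variable q : 'rV[R]_d.
Hypothesis qP : forall i j, ~~ (q - P i <= edge_span P i j)%MS.

(** Contains all differences of points of the cones over the edges [i] and [j]. Its rank is at most
    4, which is where [5 <= d] enters: [d - 1] generic coordinates are injective on it. *)
Definition cone_span (i j : 'I_n) : 'M[R]_d := (edge_span P i j + <<q - P i>>)%MS.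

Lemma rank_cone_span i j : (\rank (cone_span i j) <= 4)%N.
Proof.
apply: (leq_trans (mxrank_adds_leqif _ _)); rewrite -[4%N]/(3 + 1)%N leq_add //.
  exact: rank_edge_span.
by rewrite genmxE rank_leq_row.
Qed.

Lemma sub_cone_span i j r r' s t :
  (r *: (edge_point P i s - q) - r' *: (edge_point P j t - q) <= cone_span i j)%MS.
Proof.
have qs : (P i - q <= cone_span i j)%MS.
  by rewrite -opprB eqmx_opp (submx_trans _ (addsmxSr _ _)) // genmxE.
have h (p : 'rV[R]_d) : (p - P i <= edge_span P i j)%MS -> (p - q <= cone_span i j)%MS.
  move=> pV; rewrite -(subrKA (P i)); apply: addmx_sub qs.
  exact: submx_trans pV (addsmxSl _ _).
apply: addmx_sub; rewrite ?eqmx_opp; apply: scalemx_sub; apply: h.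
  exact: edge_point_span1.
exact: edge_point_span2.
Qed.

Definition polygon_cone i : 'rV[R]_2 -> 'rV[R]_d :=
  cone_map n%:R (polygon_param i) q.

(** Differences of cone points lie in spaces of rank at most 4, those of curve points in spaces of
    rank at most 3, so [d - 1] and [d - 2] generic coordinates suffice. The starting vertex [i0] is
    the one with the largest coordinate [x]. *)
Lemma polygon_cone_normal_form : exists i, forall h : 'rV[R]_2 -> 'rV[R]_2,
  continuous h -> set_inj disk h ->
  ambient_equiv disk (polygon_cone i)
    (fun v => join_coords (ltnW (ltnW (ltnW d5))) (h v, 0)).
Proof.
have [|M Mu [Mdiff Mspan]] := @generic_matrix R d
  [seq P ij.1 - P ij.2 | ij <- enum {: 'I_n * 'I_n} & ij.1 != ij.2]
  ([seq edge_span P ij.1 ij.2 | ij <- enum {: 'I_n * 'I_n}] ++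
   [seq cone_span ij.1 ij.2 | ij <- enum {: 'I_n * 'I_n}]).
  move=> w /mapP [[i j]]; rewrite mem_filter /= => /andP[ij _] ->.
  by rewrite subr_eq0 (inj_eq (vertex_inj hP)).
have n0 : (0 < n)%N by case: hP.
have n0R : 0 < n%:R :> R by rewrite ltr0n.
have xd : (2 < d)%N by exact: leq_trans d5.
pose x := Ordinal xd.
pose f i := (P i *m M) 0 x.
have coordB (u w : 'rV[R]_d) j : ((u - w) *m M) 0 j = (u *m M) 0 j - (w *m M) 0 j.
  by rewrite mulmxBl mxE [in X in _ + X]mxE.
have [i0 i0max] : exists i0, forall i, f i <= f i0.
  exists [arg max_(i > Ordinal n0) f i]%O => i.
  by case: arg_maxP => // j _ jmax; exact: (jmax i isT).
(* The maximum is strict because the vertex differences were included in the generic family, which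
   separates all vertices in every coordinate. *)
have i0lt i : i != i0 -> f i < f i0.
  move=> ii0; rewrite lt_neqAle i0max andbT -subr_eq0.
  have := Mdiff (P i - P i0) x; rewrite coordB; apply.
  by apply/mapP; exists (i, i0) => //; rewrite mem_filter /= ii0 mem_enum.
exists i0 => h ch ih.
pose c s := polygon_param i0 s - q.
have [|||tau [ctau tauN tauP]] := @separating_function R n
  (fun k => ((polygon_vertex i0 k - q) *m M) 0 x) (fun s => (c s *m M) 0 x) simple_polygon_gt1.
- move=> k r kn r01; rewrite /c /polygon_param piecewise_linearE //.
  have -> : (1 - r) *: polygon_vertex i0 k + r *: polygon_vertex i0 k.+1 - q =
      (1 - r) *: (polygon_vertex i0 k - q) + r *: (polygon_vertex i0 k.+1 - q).
    by apply/rowP => m; rewrite !mxE; ring.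
  by rewrite mulmxDl -!scalemxAl [LHS]mxE; congr (_ + _); rewrite [LHS]mxE.
- by rewrite /polygon_vertex iter_ordSn.
- move=> k /andP[k0 kn]; rewrite /polygon_vertex !coordB ltrD2r.
  apply: i0lt.
  by apply/eqP => /(@iter_ordS_inj i0 k 0 kn n0) kE; rewrite kE in k0.
apply: (@cone_unknotting R d n%:R _ q M x tau) => //.
- exact: polygon_param_continuous.
- exact: polygon_param_closed.
- move=> v w E; have := pseudo_angle_itv v n0R; have := pseudo_angle_itv w n0R.
  move=> iw iv.
  have [k [r [kn _ _ ev]]] := polygon_param_edge i0 iv.
  have [l [t [ln _ _ ew]]] := polygon_param_edge i0 iw.
  set i := iter k _ _ in ev; set j := iter l _ _ in ew.
  have vE : cone_map n%:R (polygon_param i0) q v - q = radius v *: (edge_point P i r - q).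
    by rewrite /cone_map addrC addKr ev.
  have wE : cone_map n%:R (polygon_param i0) q w - q = radius w *: (edge_point P j t - q).
    by rewrite /cone_map addrC addKr ew.
  have : radius v *: (edge_point P i r - q) - radius w *: (edge_point P j t - q) = 0.
    apply: (Mspan (cone_span i j)).
    + by rewrite mem_cat; apply/orP; right; apply/mapP; exists (i, j); rewrite ?mem_enum.
    + exact: sub_cone_span.
    + move=> m mr; rewrite -vE -wE coordB E ?subrr //.
      have := leq_trans mr (rank_cone_span i j); lia.
  move/eqP; rewrite subr_eq0 => /eqP /(cone_edge_inj qP) [rr cc].
  apply: (polar_eq n0R) => // rw; apply: (@polygon_param_inj i0) => //.
  by case: cc => [r0|]; [rewrite -rr r0 eqxx in rw | rewrite ev ew].
- move=> s t hs ht E; apply: (@polygon_param_inj i0) => //.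
  have [k [r [kn _ _ es]]] := polygon_param_edge i0 hs.
  have [l [r' [ln _ _ et]]] := polygon_param_edge i0 ht.
  set i := iter k _ _ in es; set j := iter l _ _ in et.
  apply/eqP; rewrite -subr_eq0; apply/eqP; apply: (Mspan (edge_span P i j)).
  + by rewrite mem_cat; apply/orP; left; apply/mapP; exists (i, j); rewrite ?mem_enum.
  + by rewrite es et edge_pointB_span.
  + move=> m mr; have md : (m < d - 2)%N.
      by have := leq_trans mr (rank_edge_span P i j); lia.
    by have := E m md; rewrite !coordB => /addIr ->; rewrite subrr.
Qed.

End PolygonCone.

(** * Charts *)

Section PolygonConeImage.
Variables (R : realType) (d n : nat) (P : 'I_n -> 'rV[R]_d) (q : 'rV[R]_d).
Hypothesis hP : simple_polygon P.
Hypothesis qP : forall i j, ~~ (q - P i <= edge_span P i j)%MS.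
Variable i0 : 'I_n.

Let n0 : 0 < n%:R :> R.
Proof. by rewrite ltr0n; case: hP. Qed.

Lemma polygon_cone_image : polygon_cone P q i0 @` disk = carrier (cone_complex P q).
Proof.
apply/seteqP; split => [_ [v /diskE rv <-]|x /(carrier_coneP hP qP)].
  apply/(carrier_coneP hP qP).
  have [k [r [_ /andP[r0 r1] _ e]]] := polygon_param_edge P i0 (pseudo_angle_itv v n0).
  exists (iter k (@ordS n) i0), (radius v), r; split => //.
  - by rewrite radius_ge0.
  - by rewrite r0 ltW.
  - by rewrite -e.
move=> [i [r [s [/andP[r0 r1] s01 ->]]]].
have [t t0n <-] := polygon_param_surj P i0 i s01.
(* The apex is reached from the centre of the disk, where no angle can be prescribed. *)
move: r0; rewrite le_eqVlt => /predU1P[<-|r0].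
  exists 0; first by apply/diskE; rewrite radius0 ler01.
  by rewrite /polygon_cone /cone_map radius0 !scale0r.
have [v [rv pv]] := polar_surj n0 r0 t0n.
by exists v; [apply/diskE; rewrite rv | rewrite /polygon_cone /cone_map rv pv].
Qed.

Lemma polygon_cone_circle : polygon_cone P q i0 @` circle = polygon_curve P.
Proof.
apply/seteqP; split => [_ [v /circleE rv <-]|x /(polygon_curveP hP)].
  apply/(polygon_curveP hP).
  have [k [r [_ /andP[r0 r1] _ e]]] := polygon_param_edge P i0 (pseudo_angle_itv v n0).
  exists (iter k (@ordS n) i0), r; split; first by rewrite r0 ltW.
  by rewrite -e /polygon_cone /cone_map rv scale1r addrC subrK.
move=> [i [s [s01 ->]]]; have [t t0n <-] := polygon_param_surj P i0 i s01.
have [v [rv pv]] := polar_surj n0 ltr01 t0n.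
exists v; first exact/circleE.
by rewrite /polygon_cone /cone_map rv pv scale1r addrC subrK.
Qed.

Lemma polygon_cone_continuous : continuous (polygon_cone P q i0).
Proof.
apply: rV_continuous => j.
rewrite (_ : (fun v => _) = (fun v => q 0 j +
  radius v * (polygon_param P i0 (pseudo_angle n%:R v) 0 j - q 0 j))); last first.
  by apply/funext => v; rewrite !mxE.
have c : continuous (fun v => radius v *
    (polygon_param P i0 (pseudo_angle n%:R v) 0 j - q 0 j)).
  apply: (cone_continuous (f := fun s => polygon_param P i0 s 0 j - q 0 j)) => //.
    move=> s; apply: cvgB; last exact: cvg_cst.
    apply: (coord_continuous_comp (f := polygon_param P i0)).
    exact: polygon_param_continuous.
  by rewrite (polygon_param_closed hP).
move=> v; exact: (continuousD (@cst_continuous _ _ (q 0 j) v) (c v)).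
Qed.

End PolygonConeImage.

(** * Planar maps from the disk to a half disk *)

Section HalfDisk.
Variable R : realType.
Implicit Types u v : 'rV[R]_2.

Definition vec2 (x y : R) : 'rV[R]_2 := \row_i (if i == 0 then x else y).

Lemma vec2_0 x y : vec2 x y 0 0 = x. Proof. by rewrite mxE. Qed.
Lemma vec2_1 x y : vec2 x y 0 1 = y. Proof. by rewrite mxE. Qed.

Lemma vec2_continuous (f g : 'rV[R]_2 -> R) : continuous f -> continuous g ->
  continuous (fun v => vec2 (f v) (g v)).
Proof.
by move=> cf cg; apply: rV_continuous => i; under eq_fun do rewrite mxE; case: (i == 0).
Qed.

(* The reflection taking u to (0, -1), for u on the unit circle. *)
Definition reflect2 u v : 'rV[R]_2 :=
  vec2 (v 0 0 * u 0 1 - v 0 1 * u 0 0) (- (v 0 0 * u 0 0 + v 0 1 * u 0 1)).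

(* Maps each vertical chord of the disk affinely onto its upper half. *)
Definition fold_disk v : 'rV[R]_2 :=
  vec2 (v 0 0) ((v 0 1 + Num.sqrt (1 - v 0 0 ^+ 2)) / 2).

Lemma reflect2K u : circle u -> involutive (reflect2 u).
Proof.
rewrite /circle /= => u1 v; apply: rV2P; rewrite /reflect2 !(vec2_0, vec2_1).
  by rewrite -[RHS]mulr1 -u1; ring.
by rewrite -[RHS]mulr1 -u1; ring.
Qed.

Lemma reflect2_disk u v : circle u -> disk (reflect2 u v) <-> disk v.
Proof.
rewrite /circle /disk /= /reflect2 !(vec2_0, vec2_1) => u1.
rewrite (_ : _ + _ ^+ 2 = (v 0 0 ^+ 2 + v 0 1 ^+ 2) * (u 0 0 ^+ 2 + u 0 1 ^+ 2)); last by ring.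
by rewrite u1 mulr1.
Qed.

Lemma fold_disk_image : fold_disk @` disk = half_disk.
Proof.
apply/seteqP; split => [_ [v vd <-]|w [wd w0]].
  have [s0 s1] := (sqr_ge0 (v 0 0), sqr_ge0 (v 0 1)); rewrite /disk /= in vd.
  have h : 0 <= 1 - v 0 0 ^+ 2 by lra.
  have := sqr_sqrtr h; have := sqrtr_ge0 (1 - v 0 0 ^+ 2).
  rewrite /half_disk /disk /fold_disk /= !(vec2_0, vec2_1); set s := Num.sqrt _ => s'0 sE.
  have : `|v 0 1| <= s by rewrite -ler_sqr ?nnegrE // real_normK ?num_real //; lra.
  by rewrite ler_norml => /andP[h1 h2]; split; [nra | lra].
rewrite /disk /= in wd w0.
have [s0 s1] := (sqr_ge0 (w 0 0), sqr_ge0 (w 0 1)).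
have h : 0 <= 1 - w 0 0 ^+ 2 by lra.
have := sqr_sqrtr h; have := sqrtr_ge0 (1 - w 0 0 ^+ 2).
set s := Num.sqrt _ => s'0 sE.
have ws : w 0 1 <= s by rewrite -ler_sqr ?nnegrE //; lra.
(* The affine map from a vertical chord to its upper half is inverted. *)
exists (vec2 (w 0 0) (2 * w 0 1 - s)).
  by rewrite /disk /= !(vec2_0, vec2_1); nra.
by apply: rV2P; rewrite /fold_disk !(vec2_0, vec2_1) // -/s; lra.
Qed.

Lemma fold_disk_inj : injective fold_disk.
Proof.
move=> v w E; have := congr1 (fun a : 'rV[R]_2 => a 0 0) E.
have := congr1 (fun a : 'rV[R]_2 => a 0 1) E.
rewrite /fold_disk !(vec2_0, vec2_1) => e1 e0; apply: rV2P => //.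
by rewrite e0 in e1; lra.
Qed.

Lemma fold_disk_continuous : continuous fold_disk.
Proof.
apply: vec2_continuous; first exact: coord_continuous.
have c0 : continuous (fun v : 'rV[R]_2 => v 0 0) by exact: coord_continuous.
have c1 : continuous (fun v : 'rV[R]_2 => v 0 1) by exact: coord_continuous.
have cs : continuous (fun v : 'rV[R]_2 => Num.sqrt (1 - v 0 0 ^+ 2)).
  have ct : continuous (fun v : 'rV[R]_2 => 1 - v 0 0 ^+ 2).
    move=> v; apply: (continuousB (@cst_continuous _ _ (1 : R) v)).
    exact: (continuousM (c0 v) (c0 v)).
  by move=> v; exact: (continuous_comp (ct v) (@sqrt_continuous _ _)).
move=> v; exact: (continuousM (continuousD (c1 v) (cs v)) (@cst_continuous _ _ (2^-1 : R) v)).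
Qed.

Lemma reflect2_continuous u : continuous (reflect2 u).
Proof.
have c j : continuous (fun v : 'rV[R]_2 => v 0 j) by exact: coord_continuous.
have cM j (a : R) : continuous (fun v : 'rV[R]_2 => v 0 j * a).
  by move=> v; exact: (continuousM (c j v) (@cst_continuous _ _ a v)).
apply: vec2_continuous => v; first exact: (continuousB (cM 0 _ v) (cM 1 _ v)).
exact: (continuousN (continuousD (cM 0 _ v) (cM 1 _ v))).
Qed.

Lemma nbhs_disk v : radius v < 1 -> nbhs v disk.
Proof.
move=> rv; have e0 : 0 < 1 - radius v by rewrite subr_gt0.
have := (continuous_near_dist _ v).1 (@radius_continuous R v) _ e0.
apply: filterS => w; rewrite ltr_norml => /andP[h _].
by apply/diskE; lra.
Qed.

Lemma nbhs_cube m : nbhs (0 : 'rV[R]_m) (cube m).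
Proof.
apply/nbhs_ballP; exists 1 => //= w [_ H] i.
have := H 0 i; rewrite /ball /= mxE sub0r normrN => /ltW.
by rewrite ler_norml.
Qed.

End HalfDisk.

Section Charts.
Variables (R : realType) (d : nat).
Local Notation E := 'rV[R]_d.
Variables (g : 'rV[R]_2 -> E) (h : 'rV[R]_2 -> 'rV[R]_2).
Variables (Phi : E -> 'rV[R]_2 * 'rV[R]_(d - 2)) (Phi' : 'rV[R]_2 * 'rV[R]_(d - 2) -> E).
Hypotheses (cPhi : continuous Phi) (cPhi' : continuous Phi').
Hypotheses (PhiK : cancel Phi Phi') (Phi'K : cancel Phi' Phi).
Hypothesis Phig : forall v, disk v -> Phi (g v) = (h v, 0).

(** The chart is the restriction of a global homeomorphism to the preimage of the model. This
    preimage contains the entire surface, because its image is a subset of the disk times 0. *)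
Lemma chart_pair_homeo : h @` disk `<=` disk ->
  let N := Phi @^-1` (disk `*` cube (d - 2)) in
  pair_homeo N (N `&` g @` disk) (disk `*` cube (d - 2)) ((h @` disk) `*` [set 0]) Phi.
Proof.
move=> hd N; split.
  split; first exact: continuous_subspaceT.
    split=> [y //|y z _ _|y By]; first exact: (can_inj PhiK).
    by exists (Phi' y); rewrite ?Phi'K // /N /preimage /= Phi'K.
  by exists Phi'; [exact: continuous_subspaceT | move=> y _; exact: PhiK].
apply/seteqP; split => [_ [y [_ [v vd <-]] <-]|[a b] [/= [v vd <-] ->]].
  by rewrite Phig //; split => //=; exists v.
exists (g v); last exact: Phig.
split; last by exists v.
rewrite /N /preimage /= Phig //; split; first by apply: hd; exists v.
by move=> i; rewrite mxE lerN10 ler01.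
Qed.

Lemma chart_nbhs v : disk v -> radius (h v) < 1 ->
  nbhs (g v) (Phi @^-1` (disk `*` cube (d - 2))).
Proof.
move=> vd rv; apply: cPhi; rewrite Phig //.
by exists (disk, cube (d - 2)); [split; [exact: nbhs_disk | exact: nbhs_cube] |].
Qed.

End Charts.

Theorem theorem1p5 (R : realType) (d n : nat) (P : 'I_n -> 'rV[R]_d)
    (hd : (5 <= d)%N) (hP : simple_polygon P) :
  exists T : {fset {fset 'rV[R]_d}},
    [/\ triangulated_disk T,
        locally_flat (carrier T) (polygon_curve P),
        has_PL_boundary T P &
        #|` T|%fset = n].
Proof.
have [q qP] := generic_apex P hd.
have [i0 normal] := polygon_cone_normal_form hd hP qP.
pose g := polygon_cone P q i0.
have chart (h : 'rV[R]_2 -> 'rV[R]_2) : continuous h -> set_inj disk h ->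
    exists (Phi : 'rV[R]_d -> 'rV[R]_2 * 'rV[R]_(d - 2)) Phi',
      [/\ continuous Phi, continuous Phi', cancel Phi Phi', cancel Phi' Phi &
          forall v, disk v -> Phi (g v) = (h v, 0)].
  move=> ch ih; have [S [S' [cS cS' SK S'K Sg]]] := normal h ch ih.
  have d2 : (2 <= d)%N := ltnW (ltnW (ltnW hd)).
  exists (split_coords d2 \o S), (S' \o join_coords d2); split.
  - by move=> y; exact: (continuous_comp (cS y) (@split_coords_continuous _ _ d2 _)).
  - by move=> y; exact: (continuous_comp (@join_coords_continuous _ _ d2 y) (cS' _)).
  - by move=> y; rewrite /= split_coordsK SK.
  - by move=> y; rewrite /= S'K join_coordsK.
  - by move=> v vd; rewrite /= Sg // (eq_irrelevance d2 (ltnW (ltnW (ltnW hd)))) join_coordsK.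
have cid : continuous (@id 'rV[R]_2) by move=> v; exact: cvg_id.
(* With [h] the identity, [Phi] flattens the entire disk; its first component inverts [g]. *)
have [Phi [Phi' [cPhi cPhi' PhiK Phi'K Phig]]] := chart id cid (in2W (@inj_id _)).
have cg : continuous g by exact: polygon_cone_continuous.
have gim : g @` disk = carrier (cone_complex P q) by exact: polygon_cone_image.
have gcirc : g @` circle = polygon_curve P by exact: polygon_cone_circle.
have hg : homeo disk (carrier (cone_complex P q)) g.
  rewrite -gim; split; first exact: continuous_subspaceT.
    split=> [v vd|v w|//]; first by exists v.
    by rewrite !inE => vd wd E; have := congr1 Phi E; rewrite !Phig // => -[].
  exists (fst \o Phi); last by move=> v; rewrite inE => vd /=; rewrite Phig.
  apply: continuous_subspaceT => y.
  by apply: (continuous_comp (cPhi y)); exact: cvg_fst.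
exists (cone_complex P q); split.
- by split; [exact: triangle_complex_cone | exists g].
- rewrite -gim -gcirc; split => x.
    (* A point off the boundary curve comes from a [v] of radius below 1, so the identity chart is a
       neighbourhood of it. *)
    move=> [[v vd <-] gv]; exists (Phi @^-1` (disk `*` cube (d - 2))), Phi; split.
      apply: (chart_nbhs cPhi Phig vd); rewrite lt_neqAle (diskE v).1 // andbT.
      by apply/eqP => /circleE vc; apply: gv; exists v.
    have := @chart_pair_homeo _ _ g id _ _ cPhi cPhi' PhiK Phi'K Phig.
    by rewrite image_id; apply.
  move=> [u uc <-]; have ud : disk u by rewrite /disk /= uc.
  (* The reflection takes [u] to the lowest point of the disk, and folding takes that to the origin.
     The image of [u] is thus on the diameter of the half disk and yet interior to the full disk. *)
  pose h := @fold_disk R \o reflect2 u.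
  have hu : h u = 0.
    rewrite /h /= /reflect2 /fold_disk; apply: rV2P; rewrite !(vec2_0, vec2_1) mxE.
      by ring.
    have -> : u 0 0 * u 0 1 - u 0 1 * u 0 0 = 0 by ring.
    rewrite expr0n subr0 sqrtr1 -!expr2 uc; ring.
  have him : h @` disk = half_disk.
    rewrite -fold_disk_image /h; apply/seteqP; split => [_ [v vd <-]|_ [v vd <-]].
      by exists (reflect2 u v) => //; apply/reflect2_disk.
    by exists (reflect2 u v); [apply/reflect2_disk | rewrite /= reflect2K].
  have [] := chart h.
  - move=> v; apply: (continuous_comp (@reflect2_continuous _ u v)).
    exact: fold_disk_continuous.
  - by move=> v w _ _ /fold_disk_inj /(can_inj (reflect2K uc)).
  move=> Psi [Psi' [cPsi cPsi' PsiK Psi'K Psig]].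
  exists (Psi @^-1` (disk `*` cube (d - 2))), Psi; split.
  + by apply: (chart_nbhs cPsi Psig ud); rewrite hu radius0 ltr01.
  + rewrite -him; apply: (chart_pair_homeo cPsi cPsi' PsiK Psi'K Psig).
    by rewrite him => y [].
  + rewrite Psig // hu; split => //; split; rewrite /disk /= !mxE //.
    by rewrite expr0n addr0 ler01.
- split; last exact: boundary_edges_cone.
  by exists g; split.
- exact: card_cone_complex.
Qed.
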